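(* For every integer $k\geq 1$, there exists a connected graph $H_k$ such that $v(H_k)=\operatorname{reg}_{\Bbbk}(H_k)+k$ for every field $\Bbbk$.
   Context: Graphs are finite and simple. For a graph $G=(V,E)$ with $V=\{x_1,\ldots,x_n\}$ and a field $\Bbbk$, let $R=\Bbbk[x_1,\ldots,x_n]$ with the standard grading, and let $I(G)\subseteq R$ be the edge ideal, generated by all monomials $x_ix_j$ with $\{x_i,x_j\}\in E$. The (Castelnuovo-Mumford) regularity of $G$ over $\Bbbk$ is $\operatorname{reg}_{\Bbbk}(G):=\operatorname{reg}(R/I(G))=\max\{j-i\colon \beta_{i,j}\neq 0\}$, where $\beta_{i,j}$ are the graded Betti numbers of $R/I(G)$ in its minimal graded free resolution over $R$ (so the $i$-th free module is $\bigoplus_j R(-j)^{\beta_{i,j}}$). A set $A\subseteq V$ is independent if it contains no edge of $G$; a set $W\subseteq V$ is a vertex cover if $V\setminus W$ is independent; a minimal vertex cover is one that is minimal with respect to inclusion. For an independent set $A$, a vertex $w\in V\setminus A$ is a neighbor of $A$ if $A\cup\{w\}$ contains an edge of $G$, and $N_G(A)$ denotes the set of all neighbors of $A$. Let $\mathcal{A}(G)$ be the family of all independent sets $A$ such that $N_G(A)$ is a minimal vertex cover of $G$. The $v$-number of $G$ is $v(G):=\min\{|A|\colon A\in\mathcal{A}(G)\}$. *)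

(* Defs.v *)
From HB Require Import structures.
From mathcomp Require Import all_boot all_order all_algebra.
From mathcomp Require Import mpoly.

Set Implicit Arguments.
Unset Strict Implicit.
Unset Printing Implicit Defensive.

Import GRing.Theory.

Record sgraph (n : nat) := SGraph {
  adj :> rel 'I_n;
  adj_sym : ssrbool.symmetric adj;
  adj_irr : irreflexive adj }.

Section Graph.
Variables (n : nat) (G : sgraph n).

(* The graph with no vertices does not count as connected. *)
Definition connected : bool :=
  (0 < n) && [forall x, forall y, connect G x y].

Definition independent (A : {set 'I_n}) : bool :=
  [forall x in A, forall y in A, ~~ G x y].

Definition vertex_cover (W : {set 'I_n}) : bool := independent (~: W).

(* Meaningful for independent A only. *)
Definition neighbors (A : {set 'I_n}) : {set 'I_n} :=
  [set w | (w \notin A) && ~~ independent (w |: A)].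

Definition v_family : {set {set 'I_n}} :=
  [set A | independent A && minset vertex_cover (neighbors A)].

(* The default value n is harmless: every A has at most n elements, and v_family
   is nonempty. *)
Definition v_number : nat := \big[minn/n]_(A in v_family) #|A|.

Lemma v_family_neq0 : exists A, A \in v_family.
Proof.
have ind0 : independent set0 by apply/forall_inP=> x; rewrite inE.
have [A /maxsetP[indA maxA] _] := maxset_exists ind0.
have NA : neighbors A = ~: A.
  apply/setP=> w; rewrite !inE; case: (boolP (w \in A)) => //= wA.
  apply/negP=> indwA; case/negP: wA.
  by rewrite -(maxA _ indwA (subsetUr _ _)) setU11.
exists A; rewrite inE indA NA; apply/minsetP; split=> [|W covW WA].
  by rewrite /vertex_cover setCK.
by rewrite -(maxA _ covW) ?setCK // -(setCK A) setCS.
Qed.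

Lemma v_numberP :
  (exists2 A, A \in v_family & #|A| = v_number) /\
  (forall A, A \in v_family -> v_number <= #|A|).
Proof.
have le_v A : A \in v_family -> v_number <= #|A|.
  move=> vA; rewrite /v_number unlock; have := mem_index_enum A.
  elim: (index_enum _) => //= B s IHs; rewrite inE => /predU1P[<-|/IHs le_s].
    by rewrite vA geq_minl.
  by case: ifP => // _; apply: leq_trans le_s; apply: geq_minr.
split=> //; have [B vB] := v_family_neq0.
have [] : v_number = n \/ exists2 A, A \in v_family & #|A| = v_number.
- rewrite /v_number; elim/big_ind: _ => [|x y Hx Hy|A vA]; first by left.
    by rewrite /minn; case: ifP.
  by right; exists A.
- move=> v_n; exists B => //; apply/eqP; rewrite eqn_leq le_v // andbT v_n.
  by rewrite -[X in _ <= X]card_ord max_card.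
by [].
Qed.

End Graph.

Local Open Scope ring_scope.

Section Regularity.
Variables (K : fieldType) (n : nat).
Notation R := {mpoly K[n]}.

Definition edge_ideal (G : sgraph n) (p : R) : Prop :=
  exists c : 'I_n -> 'I_n -> R,
    p = \sum_i \sum_(j | G i j) c i j * ('X_i * 'X_j).

(* Data of a sequence ... -> F_2 -> F_1 -> F_0 -> R of finitely generated graded
   free modules F_i = \bigoplus_a R(- gdeg i a).  Elements of F_i are row
   vectors, and the maps are v |-> v *m gdiff i and v |-> v *m gaug. *)
Record free_seq := FreeSeq {
  grank : nat -> nat;
  gdeg : forall i, 'I_(grank i) -> nat;
  gdiff : forall i, 'M[R]_(grank i.+1, grank i);
  gaug : 'cV[R]_(grank 0) }.

(* p is homogeneous of degree a - b, where a negative degree forces p = 0. *)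
Definition homog_sub (a b : nat) (p : R) : bool :=
  if (b <= a)%N then p \is (a - b).-homog else p == 0.

(* gaug is read modulo I, as a degree 0 map onto R / I.  Minimality says that
   each gdiff i has its image in (x_1, ..., x_n) F_i. *)
Definition minimal_graded_free_resolution (I : R -> Prop) (C : free_seq) :
    Prop :=
  [/\ (forall b, gaug C b 0 \is (gdeg b).-homog)
      /\ (forall i a b, homog_sub (gdeg a) (gdeg b) (gdiff C i a b)),
      forall p : R, exists v : 'rV_(grank C 0), I (p - (v *m gaug C) 0 0),
      forall v : 'rV_(grank C 0),
        I ((v *m gaug C) 0 0) <-> exists w, v = w *m gdiff C 0,
      forall i (v : 'rV_(grank C i.+1)),
        v *m gdiff C i = 0 <-> exists w, v = w *m gdiff C i.+1
    & forall i a b, (gdiff C i a b)@_0%MM = 0].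

Definition betti (C : free_seq) (i j : nat) : nat :=
  #|[set a : 'I_(grank C i) | gdeg a == j]|.

(* r = reg (R / I(G)) = max {j - i : betti_(i,j) != 0}.  Minimal graded free
   resolutions exist and are unique up to graded isomorphism, so the Betti
   numbers, hence r, do not depend on the choice of C. *)
Definition is_reg (G : sgraph n) (r : nat) : Prop :=
  exists C : free_seq,
    [/\ minimal_graded_free_resolution (edge_ideal G) C,
        exists i, betti C i (i + r) != 0%N
      & forall i j, betti C i j != 0%N -> (j <= i + r)%N].

End Regularity.

(* Main.v *)
Require Import Defs.
From mathcomp Require Import all_boot all_order all_algebra.
From mathcomp Require Import mpoly zify.

Set Implicit Arguments.
Unset Strict Implicit.
Unset Printing Implicit Defensive.

Import GRing.Theory.

(** The complex behind the construction is a flag triangulation X, on 14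
    vertices, of a space resembling the dunce hat: every edge of X lies in at
    least two triangles, yet the coboundary map from edges to triangles is split
    surjective over the integers.  The complement G of its 1-skeleton, whose
    independence complex is X, therefore satisfies v(G) = 3 and reg(G) = 2 over
    every field.  Both invariants add up over disjoint unions, and neither changes
    when all edges between two copies of the same graph are added, so two copies
    of k G completely joined to each other form a suitable H_k.

    Regularity is read off the independence complex as in Hochster's formula.  The
    resolution of R / I(G) is Z^n-graded with squarefree shifts, so it is encoded
    by matrices over the field whose rows and columns are labelled by vertex sets,
    an entry c between labels S and T standing for c X^(S \ T).  Its syzygies of
    multidegree T form a space [syz T], and the minimal generators with label T
    span a complement of the sum of the spaces [syz (T \ s)].  Exactness of the
    Koszul complex of [syz] in one degree passes to the next_stage stage with a shift by
    one; going back to stage 0, generators with label T at stage i + 1 exist if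
    and only if the restriction to T of the independence complex has nonzero
    reduced cohomology at faces of size |T| - i - 1. *)

(** * Koszul complexes of squarefree modules *)

Section Coboundary.
Local Open Scope ring_scope.

Variables (n : nat) (K : fieldType).
Implicit Types (s t : 'I_n) (S T : {set 'I_n}).

Definition sgn s S : K := (-1) ^+ #|[set t in S | (t < s)%N]|.

(* The Koszul differential with its basis vectors indexed by complements: this
   makes it the simplicial coboundary. *)
Definition cob (E : lmodType K) (z : {set 'I_n} -> E) S : E :=
  \sum_(s in S) sgn s S *: z (S :\ s).

Lemma sgnU1 s t S : t \notin S -> sgn s (t |: S) = (-1) ^+ (t < s)%N * sgn s S.
Proof.
move=> tS; rewrite /sgn -exprD; congr (_ ^+ _).
case: (boolP (t < s)%N) => ts.
  rewrite -[X in (X + _)%N]/(1%N) add1n.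
  have -> : [set u in t |: S | (u < s)%N] = t |: [set u in S | (u < s)%N].
    by apply/setP=> u; rewrite !inE andb_orl; case: eqP => //= ->; rewrite ts.
  by rewrite cardsU1 inE (negbTE tS).
rewrite add0n; apply: eq_card => u; rewrite !inE andb_orl.
by case: eqP => //= ->; rewrite (negbTE ts) andbF.
Qed.

Lemma sgnD1 s t S : t \in S -> sgn s S = (-1) ^+ (t < s)%N * sgn s (S :\ t).
Proof. by move=> tS; rewrite -sgnU1 ?setD11 // setD1K. Qed.

Lemma sgnK s S : sgn s S * sgn s S = 1.
Proof. by rewrite /sgn -expr2 sqrr_sign. Qed.

Lemma sgn_setD1 s S : sgn s (S :\ s) = sgn s S.
Proof.
case: (boolP (s \in S)) => sS; last by rewrite (setDidPl _) // disjoint_sym disjoints1.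
by rewrite (sgnD1 s sS) ltnn expr0 mul1r.
Qed.

(** Of two distinct vertices exactly one precedes the other, so deleting the other vertex changes
    the sign of exactly one of them. *)
Lemma sgn_swap s t S : s \in S -> t \in S -> s != t ->
  sgn t S * sgn s (S :\ t) = - (sgn s S * sgn t (S :\ s)).
Proof.
move=> sS tS st; rewrite (sgnD1 t sS) (sgnD1 s tS).
rewrite -!mulrA [sgn s _ * _]mulrC -mulNr; congr (_ * _).
move: st; rewrite -val_eqE neq_ltn /= => /orP[] lt; rewrite lt ltnNge (ltnW lt) //=.
by rewrite expr0 expr1 opprK.
Qed.

Section Lmod.
Variable E : lmodType K.
Implicit Types (z : {set 'I_n} -> E).

Lemma eq_cob z z' S : (forall s, s \in S -> z (S :\ s) = z' (S :\ s)) ->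
  cob z S = cob z' S.
Proof. by move=> zz'; apply: eq_bigr => s /zz' ->. Qed.

Lemma cobB z z' S : cob (fun S => z S - z' S) S = cob z S - cob z' S.
Proof. by rewrite -sumrB; apply: eq_bigr => s _; rewrite scalerBr. Qed.

Lemma cob0 S : cob (fun=> 0 : E) S = 0.
Proof. by apply: big1 => s _; rewrite scaler0. Qed.

(** The double sum runs over ordered pairs of distinct vertices of [S]; the terms of [(s, t)] and
    [(t, s)] delete the same two vertices with opposite signs. *)
Lemma cobK z S : cob (cob z) S = 0.
Proof.
pose F s t := (sgn s S * sgn t (S :\ s)) *: z (S :\ s :\ t).
rewrite /cob.
have -> : \sum_(s in S) sgn s S *: \sum_(t in S :\ s) sgn t (S :\ s) *: z (S :\ s :\ t)
        = \sum_(s in S) \sum_(t in S | s != t) F s t.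
  apply: eq_bigr => s _; rewrite scaler_sumr; apply: eq_big => [t|t _].
    by rewrite !inE andbC eq_sym.
  by rewrite scalerA.
have FN s t : s \in S -> t \in S -> s != t -> F t s = - F s t.
  move=> sS tS st; rewrite /F -scaleNr (sgn_swap sS tS st).
  by congr (_ *: z _); apply/setP=> u; rewrite !inE andbCA.
have -> : \sum_(s in S) \sum_(t in S | s != t) F s t =
   \sum_(s in S) \sum_(t in S | (s < t)%N) F s t +
   \sum_(s in S) \sum_(t in S | (t < s)%N) F s t.
  rewrite -big_split; apply: eq_bigr => s sS /=.
  rewrite (bigID (fun t : 'I_n => (s < t)%N)) /=; congr (_ + _).
    apply: eq_bigl => t; rewrite -andbA -val_eqE /=; case: (t \in S) => //=.
    by case: ltngtP.
  apply: eq_bigl => t; rewrite -andbA -val_eqE /=; case: (t \in S) => //=.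
  by case: ltngtP.
rewrite [X in _ + X](exchange_big_dep (mem S)) //=; last by move=> ? ? ? /andP[].
rewrite -big_split big1 //= => s sS.
rewrite [X in _ + X](eq_bigl (fun t => (t \in S) && (s < t)%N)); last first.
  by move=> t; rewrite sS.
rewrite -big_split big1 //= => t /andP[tS st].
by rewrite (FN s t) ?addrN // neq_ltn st.
Qed.

End Lmod.

Lemma cob_mul (p m : nat) (D : 'M[K]_(p, m)) (z : {set 'I_n} -> 'rV[K]_p) S :
  cob z S *m D = cob (fun S => z S *m D) S.
Proof. by rewrite /cob mulmx_suml; apply: eq_bigr => s _; rewrite -scalemxAl. Qed.

(* Exactness in degree q of the Koszul complex of S |-> A S / B S, at T. *)
Definition cob_exact (E : lmodType K) (A B : {set 'I_n} -> E -> Prop) T q :=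
  forall z : {set 'I_n} -> E, (forall S, A S (z S)) ->
    (forall S, S \subset T -> #|S| = q.+1 -> B S (cob z S)) ->
  exists2 y : {set 'I_n} -> E, forall S, A S (y S) &
    forall S, S \subset T -> #|S| = q -> B S (z S - cob y S).

Definition supported m (lab : 'I_m -> {set 'I_n}) T (v : 'rV[K]_m) :=
  forall b, v 0 b != 0 -> lab b \subset T.

Section Supported.
Variables (m : nat) (lab : 'I_m -> {set 'I_n}).

Lemma supported_lin T c u v :
  supported lab T u -> supported lab T v -> supported lab T (c *: u + v).
Proof.
move=> uT vT b; rewrite !mxE => /eqP nz.
case: (eqVneq (u 0 b) 0) => [u0|/uT //]; apply: vT.
by apply/eqP=> v0; case: nz; rewrite u0 v0 mulr0 addr0.
Qed.

Lemma supported0 T : supported lab T 0.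
Proof. by move=> b; rewrite mxE eqxx. Qed.

Lemma supportedS S T v : S \subset T -> supported lab S v -> supported lab T v.
Proof. by move=> ST vS b /vS /subset_trans; apply. Qed.

(* For each b the sets S with lab b \subset S \subset T form a simplex on
   T :\: lab b; contract it with any of its vertices. *)
Lemma supported_exact T q (z : {set 'I_n} -> 'rV[K]_m) :
    (forall S, supported lab S (z S)) ->
    (forall S, S \subset T -> #|S| = q.+1 -> cob z S = 0) ->
    (q = #|T| -> forall b, z T 0 b != 0 -> lab b != T) ->
  exists2 y : {set 'I_n} -> 'rV[K]_m, forall S, supported lab S (y S) &
    forall S, S \subset T -> #|S| = q -> z S = cob y S.
Proof.
move=> zA zc zT.
pose y S : 'rV[K]_m := \row_b
  if [pick s in T :\: lab b] is Some s then
    if s \in S then 0 else sgn s S * z (s |: S) 0 b else 0.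
exists y => [S b|S ST Sq].
  rewrite mxE; case: pickP => [s|_]; last by rewrite eqxx.
  rewrite inE => /andP[sb sT]; case: ifP => [_|/negbT sS]; first by rewrite eqxx.
  rewrite mulf_eq0 negb_or => /andP[_ /zA /subsetP lS].
  apply/subsetP=> u ub; have := lS u ub; rewrite !inE => /predU1P[us|//].
  by rewrite -us ub in sb.
apply/rowP=> b; rewrite summxE.
case: (pickP (mem (T :\: lab b))) => [s|nos]; last first.
  (* With no vertex to contract along, [z S 0 b] can be nonzero only for [S = T = lab b], which the
     last hypothesis excludes. *)
  have Tb : T \subset lab b.
    by apply/subsetP=> u uT; have /= := nos u; rewrite !inE uT andbT => /negbFE.
  rewrite big1 => [|t tS]; last first.
    rewrite !mxE; case: pickP => [s /= sb|_]; last by rewrite mulr0.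
    by have /= := nos s; rewrite sb.
  apply/eqP; apply: contraT => nz; have bS := zA _ _ nz.
  have ES : S = T by apply/eqP; rewrite eqEsubset ST (subset_trans Tb bS).
  move: nz; rewrite ES => /zT; rewrite -Sq ES => /(_ erefl) /negP; case.
  by rewrite eqEsubset Tb -ES bS.
rewrite /= inE => /andP[sb sT].
have ypick S' : y S' 0 b =
    if [pick s in T :\: lab b] is Some s then
    if s \in S' then 0 else sgn s S' * z (s |: S') 0 b else 0 by rewrite mxE.
case: (pickP (mem (T :\: lab b))) ypick => [s' /= |/(_ s)]; last first.
  by rewrite /= inE sb sT.
rewrite inE => /andP[sb' sT'] yE; move: s' sb' sT' yE {s sb sT} => s sb sT yE.
case: (boolP (s \in S)) => sS.
  rewrite (bigD1 s) //= big1 => [|t /andP[tS ts]].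
    rewrite mxE yE !inE eqxx /= addr0 setD1K // sgn_setD1 mulrA sgnK mul1r //.
  by rewrite mxE yE !inE eq_sym ts sS /= mulr0.
(* The cocycle condition at [s |: S] expresses [z S 0 b] through values of [z] on sets containing
   [s], and these are the entries of [y]. *)
have csS : #|s |: S| = q.+1 by rewrite cardsU1 sS add1n Sq.
have := zc (s |: S); rewrite subUset sub1set sT ST csS => /(_ isT erefl).
move=> /rowP/(_ b); rewrite summxE (bigD1 s) ?setU11 //= !mxE.
rewrite setU1K // -sgn_setD1 setU1K //.
move=> /eqP; rewrite addr_eq0 => /eqP zE.
rewrite -[LHS]mul1r -(sgnK s S) -mulrA zE mulrN mulr_sumr -sumrN.
apply: eq_big => [t|t /andP[]].
  by rewrite !inE; case: eqP => [->|]; rewrite ?(negbTE sS) //= andbT.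
rewrite in_setU1 => /orP[/eqP->|tS] ts; first by rewrite eqxx in ts.
rewrite [in RHS]mxE yE inE (negbTE sS) andbF /= mxE.
have E1 : (s |: S) :\ t = s |: S :\ t.
  by apply/setP=> u; rewrite !inE; case: (eqVneq u s) => [->|//]; rewrite eq_sym ts.
rewrite E1 -mulNr !mulrA; congr (_ * _).
have := @sgn_swap s t (s |: S).
rewrite setU11 in_setU1 tS orbT eq_sym ts => /(_ isT isT isT).
rewrite E1 setU1K // -[sgn s (s |: _ :\ t)]sgn_setD1 -[sgn s (s |: _)]sgn_setD1.
rewrite !setU1K ?inE ?(negbTE sS) ?andbF // => sw.
rewrite -[sgn t _]mulr1 -(sgnK s (S :\ t)) [sgn t _ * _]mulrA sw.
by rewrite !mulNr mulrN opprK -!mulrA mulrA sgnK mul1r.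
Qed.

End Supported.

End Coboundary.

(** * Dimension shift of Koszul exactness along a presentation *)

Section Shift.
Local Open Scope ring_scope.

Variables (n : nat) (K : fieldType) (p m : nat).
Variables (A B : {set 'I_n} -> 'rV[K]_p -> Prop).
Variables (lab : 'I_m -> {set 'I_n}) (D : 'M[K]_(m, p)).
Implicit Types (S T : {set 'I_n}).

Hypothesis B0 : forall T, B T 0.
Hypothesis B_lin : forall T c u v, B T u -> B T v -> B T (c *: u + v).
Hypothesis BS : forall S T u, S \subset T -> B S u -> B T u.
Hypothesis D_mem : forall T v, supported lab T v -> A T (v *m D).
Hypothesis D_onto : forall T u, A T u ->
  exists v, supported lab T v /\ B T (v *m D - u).

Definition relations T (v : 'rV[K]_m) := supported lab T v /\ B T (v *m D).

Lemma relations_lift (z : {set 'I_n} -> 'rV[K]_p) : (forall S, A S (z S)) ->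
  exists2 f : {set 'I_n} -> 'rV[K]_m, forall S, supported lab S (f S) &
    forall S, B S (f S *m D - z S).
Proof.
move=> zA; have [f fP] := @fin_all_exists _ _
  (fun S v => supported lab S v /\ B S (v *m D - z S)) (fun S => D_onto (zA S)).
by exists f => S; case: (fP S).
Qed.

Let B_opp T u : B T u -> B T (- u).
Proof. by move=> Bu; rewrite -[- u]addr0 -scaleN1r; apply: B_lin. Qed.

Let B_add T u v : B T u -> B T v -> B T (u + v).
Proof. by move=> Bu; rewrite -[u]scale1r; apply: B_lin. Qed.

Let B_cob (z : {set 'I_n} -> 'rV[K]_p) : (forall S, B S (z S)) ->
  forall S, B S (cob z S).
Proof.
move=> zB S; rewrite /cob; elim/big_ind: _ => [|u v|s sS]; first exact: B0.
  exact: B_add.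
rewrite -[_ *: _]addr0; apply: B_lin; last exact: B0.
by apply: BS (zB _); apply: subD1set.
Qed.

Lemma supported_cob (z : {set 'I_n} -> 'rV[K]_m) :
  (forall S, supported lab S (z S)) -> forall S, supported lab S (cob z S).
Proof.
move=> zF S; rewrite /cob; elim/big_ind: _ => [|u v uF vF|s sS].
- exact: supported0.
- by rewrite -[u]scale1r; apply: supported_lin.
rewrite -[_ *: _]addr0; apply: supported_lin; last exact: supported0.
by apply: supportedS (zF _); apply: subD1set.
Qed.

(** [cob_exact] asks for membership at every set, while the families built below satisfy the
    relations only on the [q]-element subsets of [T]. *)
Definition trunc T q (z : {set 'I_n} -> 'rV[K]_m) S : 'rV[K]_m :=
  if (S \subset T) && (#|S| == q) then z S else 0.

Lemma trunc_relations T q z : (forall S, S \subset T -> #|S| = q -> relations S (z S)) ->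
  forall S, relations S (trunc T q z S).
Proof.
move=> zR S; rewrite /trunc; case: ifP => [/andP[ST /eqP Sq]|_]; first exact: zR.
by split; [apply: supported0 | rewrite mul0mx; apply: B0].
Qed.

Lemma cob_trunc T q z S : S \subset T -> #|S| = q.+1 -> cob (trunc T q z) S = cob z S.
Proof.
move=> ST Sq; apply: eq_cob => s sS; rewrite /trunc (subset_trans (subD1set _ _) ST) /=.
by move: Sq; rewrite (cardsD1 s) sS add1n => -[->]; rewrite eqxx.
Qed.

(* 0 -> relations -> free module on lab -> A / B -> 0 is exact, and the free
   module has no Koszul homology apart from generators with label T. *)
Lemma shift_exact T q : (q < #|T|)%N ->
    (forall v b, relations T v -> v 0 b != 0 -> lab b != T) ->
  cob_exact A B T q <-> cob_exact relations (fun=> eq^~ 0) T q.+1.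
Proof.
move=> qT minT; split=> [exA z zR zc|exR z zA zc].
(* In the free module [z] is the coboundary of some [f]. Its image under [D] is a cocycle modulo
   [B], hence a coboundary there, and a lift of the primitive corrects [f] to a relation. *)
- have zF S : supported lab S (z S) by case: (zR S).
  have zcs S : S \subset T -> #|S| = q.+2 -> cob z S = 0 by move=> *; apply: zc.
  have [|f fF zf] := supported_exact zF zcs.
    by move=> _ b; apply: minT.
  have [||y yA gy] := exA (fun S => f S *m D).
  + by move=> S; apply: D_mem.
  + by move=> S ST Sq; rewrite -cob_mul -zf //; case: (zR S).
  have [y' y'F y'y] := relations_lift yA.
  have y'c := supported_cob y'F.
  exists (trunc T q (fun S => f S - cob y' S)).
    apply: trunc_relations => S ST Sq; split.
      by rewrite -[f S - _]addrC -scaleN1r; apply: supported_lin.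
    rewrite mulmxBl cob_mul.
    have -> : f S *m D - cob (fun S => y' S *m D) S =
      (f S *m D - cob y S) - cob (fun S => y' S *m D - y S) S.
      by rewrite cobB opprB addrA subrK.
    by apply: B_add; [apply: gy | apply/B_opp/B_cob].
  by move=> S ST Sq; rewrite cob_trunc // cobB cobK subr0 zf ?subrr.
(* Conversely, lift [z] to [f]: then [cob f] is a cocycle of relations, hence some [cob y], and
   [f - y] is a cocycle of the free module, hence some [cob h]; the image of [h] is the
   primitive. *)
have [f fF fz] := relations_lift zA.
have cF := supported_cob fF.
have [||y yR zy] := exR (trunc T q.+1 (cob f)).
- apply: trunc_relations => S ST Sq; split=> //.
  rewrite cob_mul.
  have -> : cob (fun S => f S *m D) S = cob (fun S => f S *m D - z S) S + cob z S.
    by rewrite cobB subrK.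
  by apply: B_add; [apply: B_cob | apply: zc].
- by move=> S ST Sq; rewrite cob_trunc // cobK.
have yF S : supported lab S (y S) by case: (yR S).
have [|||h hF hfy] := @supported_exact n K m lab T q (fun S => f S - y S).
- by move=> S; rewrite addrC -scaleN1r; apply: supported_lin.
- move=> S ST Sq; rewrite cobB; have := zy S ST Sq.
  by rewrite /trunc ST Sq eqxx.
- by move=> qE; rewrite qE ltnn in qT.
exists (fun S => h S *m D) => [S|S ST Sq]; first exact: D_mem.
rewrite -cob_mul -hfy // mulmxBl opprB addrCA; apply: B_add; first by case: (yR S).
by rewrite -opprB; apply: B_opp.
Qed.

End Shift.

(** * Minimal free resolutions of squarefree ideals *)

Section Stages.
Local Open Scope ring_scope.

Variables (n : nat) (K : fieldType).
Implicit Types (S T : {set 'I_n}).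

(* The rows of [syz T] span the syzygies of multidegree T, as vectors supported on
   the generators whose label is included in T. *)
Record stage := Stage {
  rk : nat;
  lab : 'I_rk -> {set 'I_n};
  syz : {set 'I_n} -> 'M[K]_rk }.

(** The second clause is minimality: a generator labelled [T] would enter a syzygy of multidegree
    [T] with a unit coefficient. *)
Definition stage_inv (st : stage) :=
  (forall S T, S \subset T -> (syz st S <= syz st T)%MS) /\
  (forall T (v : 'rV_(rk st)) b, (v <= syz st T)%MS -> v 0 b != 0 -> lab b \proper T).

Section Next.
Variable st : stage.

Definition old_syz T := (\sum_(s in T) syz st (T :\ s))%MS.
Definition new_syz T := (syz st T :\: old_syz T)%MS.
Definition gens := {T : {set 'I_n} & 'I_(\rank (new_syz T))}.
Definition gen_ord T (i : 'I_(\rank (new_syz T))) : 'I_#|{: gens}| :=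
  enum_rank (Tagged (fun T => 'I_(\rank (new_syz T))) i : gens).
Definition gen_lab (a : 'I_#|{: gens}|) := tag (enum_val a).
Definition gen_mx : 'M[K]_(#|{: gens}|, rk st) :=
  \matrix_a row (tagged (enum_val a)) (row_base (new_syz (tag (enum_val a)))).

(** A projection whose row space consists of the vectors supported inside [T], so that the support
    condition can be intersected with a kernel. *)
Definition supp_mx T : 'M[K]_#|{: gens}| := diag_mx (\row_b (gen_lab b \subset T)%:R).

Definition next_stage := Stage gen_lab (fun T => kermx gen_mx :&: supp_mx T)%MS.

Lemma supp_mxP T (v : 'rV_#|{: gens}|) :
  reflect (supported gen_lab T v) (v <= supp_mx T)%MS.
Proof.
apply: (iffP idP) => [/submxP[u ->] b|vT].
  by rewrite mul_mx_diag !mxE; case: (_ \subset _); rewrite ?mulr0 ?eqxx.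
suff -> : v = v *m supp_mx T by apply: submxMl.
apply/rowP=> b; rewrite mul_mx_diag !mxE;
case: (boolP (_ \subset _)) => [_|]; rewrite ?mulr1 //.
by rewrite mulr0; apply: contraNeq => /vT.
Qed.

Lemma next_stage_syzP T (v : 'rV_#|{: gens}|) :
  reflect (v *m gen_mx = 0 /\ supported gen_lab T v) (v <= syz next_stage T)%MS.
Proof.
rewrite sub_capmx; apply: (iffP andP) => [[/sub_kermxP ? /supp_mxP]|[? ?]] //.
by split; [apply/sub_kermxP | apply/supp_mxP].
Qed.

Hypothesis inv : stage_inv st.

Lemma syzS S T : S \subset T -> (syz st S <= syz st T)%MS.
Proof. by case: inv => mono _; apply: mono. Qed.

Lemma gen_row a : (row a gen_mx <= new_syz (gen_lab a))%MS.
Proof. by rewrite rowK (submx_trans (row_sub _ _)) ?eq_row_base. Qed.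

Lemma new_syz_sub T : (new_syz T <= syz st T)%MS.
Proof. exact: diffmxSl. Qed.

Lemma gen_mx_sub T (v : 'rV_#|{: gens}|) :
  supported gen_lab T v -> (v *m gen_mx <= syz st T)%MS.
Proof.
move=> vT; rewrite mulmx_sum_row; apply: summx_sub => a _.
case: (eqVneq (v 0 a) 0) => [->|/vT aT]; first by rewrite scale0r sub0mx.
apply/scalemx_sub/(submx_trans (gen_row a))/(submx_trans (new_syz_sub _)).
exact: syzS.
Qed.

(** Graded Nakayama by induction on [#|T|]: [syz st T] is spanned by [new_syz T], whose basis rows
    are rows of [gen_mx], and by the spaces [syz st (T :\ s)]. *)
Lemma gen_mx_onto T (u : 'rV_(rk st)) : (u <= syz st T)%MS ->
  exists2 v : 'rV_#|{: gens}|, supported gen_lab T v & v *m gen_mx = u.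
Proof.
suff sub : (syz st T <= supp_mx T *m gen_mx)%MS.
  move=> uT; have /submxP[w ->] := submx_trans uT sub.
  exists (w *m supp_mx T); last by rewrite mulmxA.
  exact/supp_mxP/submxMl.
have [k Tk] := ubnP #|T|; elim: k => // k IHk in T Tk *.
have suppS S S' : S \subset S' -> (supp_mx S <= supp_mx S')%MS.
  move=> SS'; apply/row_subP=> i; apply/supp_mxP.
  by apply: supportedS SS' _; apply/supp_mxP/row_sub.
suff : (new_syz T + old_syz T <= supp_mx T *m gen_mx)%MS.
  apply: submx_trans; rewrite -(addsmx_diff_cap_eq (syz st T) (old_syz T)).
  by rewrite addsmxS // capmxSr.
rewrite addsmx_sub; apply/andP; split.
  rewrite -(eq_row_base (new_syz T)); apply/row_subP=> i.
  pose a := gen_ord i.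
  have -> : row i (row_base (new_syz T)) = delta_mx 0 a *m gen_mx.
    by rewrite -rowE rowK /a /gen_ord enum_rankK.
  apply/submxMr/supp_mxP => b; rewrite mxE eqxx /=.
  by case: (eqVneq b a) => [->|]; rewrite ?eqxx // /gen_lab /a /gen_ord enum_rankK.
apply/sumsmx_subP=> s sT; apply: (submx_trans (IHk _ _)).
  by move: Tk; rewrite (cardsD1 s) sT.
by apply/submxMr/suppS/subD1set.
Qed.

(** Generators labelled [T] contribute an element of [new_syz T], all others one of [old_syz T].
    These spaces meet in zero and the rows of a basis are free, so the coefficients at label [T]
    vanish. *)
Lemma gen_mx_free T (v : 'rV_#|{: gens}|) b :
  v *m gen_mx = 0 -> supported gen_lab T v -> v 0 b != 0 -> gen_lab b != T.
Proof.
move=> v0 vT; apply: contraNneq => bT.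
pose w : 'rV[K]_(\rank (new_syz T)) :=
  \row_i v 0 (gen_ord i).
have sum0 : w *m row_base (new_syz T) + \sum_(S | S != T) \sum_i
    v 0 (gen_ord i) *:
      row i (row_base (new_syz S)) = 0.
  rewrite -[RHS]v0 [RHS]mulmx_sum_row
    [RHS](reindex (fun u : gens => enum_rank u)) /=; last first.
    by exists enum_val => ? _; rewrite ?enum_valK ?enum_rankK.
  rewrite (eq_bigr (fun u : gens => v 0 (gen_ord (tagged u)) *:
    row (tagged u) (row_base (new_syz (tag u))))) => [|[S i] _]; last first.
    by rewrite rowK /gen_ord enum_rankK.
  rewrite -(@sig_big_dep _ _ _ _ _ xpredT (fun _ => xpredT)
    (fun S i => v 0 (gen_ord i) *: row i (row_base (new_syz S)))) /=.
  rewrite [RHS](bigD1 T) //= mulmx_sum_row; congr (_ + _).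
  by apply: eq_bigr => i _; rewrite mxE.
have wT : (w *m row_base (new_syz T) <= new_syz T :&: old_syz T)%MS.
  rewrite sub_capmx (submx_trans (submxMl _ _)) ?eq_row_base //=.
  move/eqP: sum0; rewrite addr_eq0 => /eqP ->; rewrite eqmx_opp.
  apply: summx_sub => S ST; apply: summx_sub => i _.
  set a := gen_ord _; case: (eqVneq (v 0 a) 0) => [->|va].
    by rewrite scale0r sub0mx.
  have := vT a va; rewrite /gen_lab /a /gen_ord enum_rankK /= => sST.
  have [s sT sS] : exists2 s, s \in T & s \notin S.
    by apply/subsetPn; move: ST; rewrite eqEsubset sST.
  apply/scalemx_sub/(submx_trans (row_sub _ _)); rewrite eq_row_base.
  apply: (submx_trans (new_syz_sub _)); apply: (sumsmx_sup s) => //.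
  by apply: syzS; rewrite subsetD1 sST.
have : w = 0.
  apply: (row_free_inj (row_base_free (new_syz T))); rewrite mul0mx.
  by apply/eqP; rewrite -submx0 -(capmx_diff (syz st T) (old_syz T)).
(* The label of [b] is [T] only up to a proved equality, along which its basis index is
   transported. *)
have eqr := congr1 (fun S => \rank (new_syz S)) bT.
move=> /rowP/(_ (cast_ord eqr (tagged (enum_val b)))).
rewrite !mxE => v0b; apply/eqP; apply: etrans v0b; congr (v 0 _);
rewrite -[LHS]enum_valK; congr enum_rank.
move: bT eqr; rewrite /gen_lab; case: (enum_val b) => S i /= ES eqr.
by case: T / ES eqr {v vT w wT v0 sum0} => eqr; rewrite cast_ord_id.
Qed.

Lemma next_stage_inv : stage_inv next_stage.
Proof.
split=> [S T ST|T v b /next_stage_syzP[v0 vT] nz].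
  apply/row_subP=> i; apply/next_stage_syzP.
  have /next_stage_syzP[r0 rS] := row_sub i (syz next_stage S).
  by split=> //; apply: supportedS rS.
by rewrite properEneq (gen_mx_free v0 vT nz) vT.
Qed.

(** Strictness makes every nonzero entry of the homogenized differential a multiple of a monomial of
    positive degree. *)
Lemma gen_mx_lab a b : gen_mx a b != 0 -> lab b \proper gen_lab a.
Proof.
move=> nz; case: inv => _ /(_ (gen_lab a) (row a gen_mx)); apply; last by rewrite mxE.
exact: submx_trans (gen_row a) (new_syz_sub _).
Qed.

Definition syz_exact (st : stage) T q :=
  cob_exact (E := 'rV[K]_(rk st)) (fun S v => (v <= syz st S)%MS) (fun _ v => v = 0) T q.

Lemma next_stage_exact T q : (q < #|T|)%N ->
  syz_exact st T q <-> syz_exact next_stage T q.+1.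
Proof.
move=> qT; have [] := @shift_exact n K _ _ (fun S v => (v <= syz st S)%MS)
  (fun _ v => v = 0) gen_lab gen_mx _ _ _ _ _ T q qT.
- by [].
- by move=> _ c u v -> ->; rewrite scaler0 addr0.
- by [].
- by move=> S v; apply: gen_mx_sub.
- move=> S u /gen_mx_onto[v vS vu]; exists v; split=> //.
  by rewrite vu subrr.
- by move=> v b [vT v0]; apply: gen_mx_free.
have relE S v : relations (fun _ v => v = 0) gen_lab gen_mx S v <->
    (v <= syz next_stage S)%MS.
  by split=> [[? ?]|/next_stage_syzP[]]; [apply/next_stage_syzP|].
move=> exL exR; split=> [/exL ex z zA|ex].
  by move=> /(ex z (fun S => (relE S _).2 (zA S)))[y /(_ _)/relE ? ?]; exists y.
apply: exR => z zA; case/(ex z (fun S => (relE S _).1 (zA S))) => y yA ?.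
by exists y => // S; apply/relE.
Qed.

(** No subset of [T] has more than [#|T|] elements, so in this degree there is no cocycle condition,
    and exactness says that [syz st T] is the sum of the spaces [syz st (T :\ s)]. *)
Lemma new_syz_eq0 T : syz_exact st T #|T| <-> \rank (new_syz T) = 0.
Proof.
have rank0 : \rank (new_syz T) = 0 <-> (syz st T <= old_syz T)%MS.
  split=> [/eqP|sub]; last first.
    apply/eqP; rewrite mxrank_eq0 -submx0 -(capmx_diff (syz st T) (old_syz T)).
    by rewrite sub_capmx submx_refl (submx_trans (new_syz_sub T)).
  rewrite mxrank_eq0 => /eqP f0; rewrite -(addsmx_diff_cap_eq (syz st T) (old_syz T)).
  by rewrite addsmx_sub capmxSr -/(new_syz T) f0 sub0mx.
rewrite rank0; split=> [ex|/sub_sumsmxP[u uE] z zA _].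
  apply/row_subP=> i.
  have [|S ST|y yA yE] := ex (fun S => if S == T then row i (syz st T) else 0).
  - by move=> S; case: eqP => [->|_]; rewrite ?sub0mx ?row_sub.
  - by move=> /eqP; rewrite eqn_leq [(_ < _)%N]ltnNge subset_leq_card // andbF.
  have /eqP := yE T (subxx _) erefl; rewrite eqxx subr_eq0 => /eqP ->.
  apply: summx_sub => s sT; apply/scalemx_sub/(sumsmx_sup s) => //.
have [w wE] := submxP (zA T).
exists (fun S => \sum_(s in T | T :\ s == S)
    sgn K s T *: (w *m (u s *m syz st (T :\ s)))).
  move=> S; apply: summx_sub => s /andP[_ /eqP <-]; apply: scalemx_sub.
  by rewrite mulmxA submxMl.
move=> S ST SE; have -> : S = T by apply/eqP; rewrite eqEcard ST SE leqnn.
apply/eqP; rewrite subr_eq0 wE uE mulmx_sumr; apply/eqP; apply: eq_bigr => s sT.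
rewrite (bigD1 s) ?sT ?eqxx //= big1 ?addr0 ?scalerA ?sgnK ?scale1r //.
move=> t /andP[/andP[tT /eqP E] ts].
by have := setD11 s T; rewrite -E !inE eq_sym ts sT.
Qed.

End Next.

Section Resolution.
Variable face : pred {set 'I_n}.
Hypothesis face0 : face set0.
Hypothesis faceS : forall S T, S \subset T -> face T -> face S.

(* The free module R with syz the squarefree ideal of nonfaces. *)
Definition stage0 := @Stage 1 (fun=> set0) (fun T => if face T then 0 else 1%:M).
Fixpoint stages i := if i is j.+1 then next_stage (stages j) else stage0.

Lemma stages_inv i : stage_inv (stages i).
Proof.
elim: i => [|i IHi]; last exact: next_stage_inv.
split=> [S T ST|T v b] /=.
  case: ifP => fS; first exact: sub0mx.
  by case: ifP => [/(faceS ST)|]; rewrite ?fS.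
case: ifP => [_|fT _ _]; first by rewrite submx0 => /eqP ->; rewrite mxE eqxx.
by rewrite properEneq sub0set andbT; apply: contraFneq fT => <-.
Qed.

(** The quotient is [E] on faces and 0 elsewhere, so this is vanishing of the reduced cohomology, in
    degree [q - 1], of the restriction of the complex to [T]. *)
Definition face_exact (E : lmodType K) T q :=
  cob_exact (E := E) (fun _ _ => True) (fun S v => face S -> v = 0) T q.

(** The shift applied to the Stanley-Reisner ring as a quotient of the free module of rank 1; its
    label [set0] differs from [T] because [q < #|T|]. *)
Lemma stage0_exact T q : (q < #|T|)%N ->
  face_exact 'rV[K]_1 T q <-> syz_exact stage0 T q.+1.
Proof.
move=> qT; have [] := @shift_exact n K _ _ (fun _ _ => True)
  (fun S v => face S -> v = 0) (fun=> set0 : {set 'I_n}) (1%:M : 'M_1) _ _ _ _ _ T q qT.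
- by [].
- by move=> S c u v uS vS fS; rewrite uS ?vS // scaler0 addr0.
- by move=> S S' u SS' uS /(faceS SS')/uS.
- by [].
- move=> S u _; exists u; rewrite mulmx1 subrr; split=> // b _; exact: sub0set.
- by move=> v b _ _; rewrite eq_sym -card_gt0 (leq_ltn_trans _ qT).
have relE S (v : 'rV_1) : (v <= syz stage0 S)%MS <->
    relations (fun S v => face S -> v = 0) (fun=> set0 : {set 'I_n}) 1%:M S v.
  apply: iff_sym; rewrite /relations mulmx1 /=; case: ifP => fS; last first.
    by rewrite submx1; split=> // _; split=> // ? _; exact: sub0set.
  rewrite submx0; split=> [[_ /(_ isT) ->]//|/eqP ->].
  by split=> // ? _; exact: sub0set.
move=> exL exR; split=> [/exL ex z zA|ex].
  by move=> /(ex z (fun S => (relE S _).1 (zA S)))[y /(_ _)/relE ? ?]; exists y.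
apply: exR => z zA; case/(ex z (fun S => (relE S _).2 (zA S))) => y yA ?.
by exists y => // S; apply/relE.
Qed.

Lemma stages_exact i T q : (q + i < #|T|)%N ->
  face_exact 'rV[K]_1 T q <-> syz_exact (stages i) T (q + i).+1.
Proof.
elim: i => [|i IHi] qT; first by rewrite addn0 in qT *; apply: stage0_exact.
rewrite addnS in qT *; rewrite IHi; last exact: ltnW.
exact: next_stage_exact (stages_inv i) _ _ qT.
Qed.

(** The [i + 1] shifts move degree [q] to degree [#|T|], where exactness of stage [i] means that no
    new generator labelled [T] is needed. *)
Lemma stages_gens i T q : #|T| = (q + i).+1 ->
  face_exact 'rV[K]_1 T q <-> (forall a, lab (s := stages i.+1) a != T).
Proof.
move=> TE; have qT : (q + i < #|T|)%N by rewrite TE.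
rewrite (stages_exact qT) -TE new_syz_eq0.
split=> [r0 a|noT].
  rewrite /= /gen_lab; case: (enum_val a) => S j /=.
  by apply/eqP=> ST; case: T / ST {TE qT} r0 => r0; case: (cast_ord r0 j).
case E: (\rank _) => [//|r].
pose j : 'I_(\rank (new_syz (stages i) T)) := cast_ord (esym E) ord0.
have := noT (gen_ord j).
by rewrite /= /gen_lab /gen_ord enum_rankK eqxx.
Qed.

End Resolution.
End Stages.

(** * From labelled matrices over the field to multigraded polynomial matrices *)

Section Homogenization.
Local Open Scope ring_scope.

Variables (n : nat) (K : fieldType).
Notation R := {mpoly K[n]}.
Implicit Types (S T : {set 'I_n}) (a e : 'X_{1..n}).

Definition set_mnm S : 'X_{1..n} := [multinom nat_of_bool (i \in S) | i < n].
Definition mnm_supp a : {set 'I_n} := [set i | a i != 0%N].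

Lemma set_mnm_le S a : (set_mnm S <= a)%MM = (S \subset mnm_supp a).
Proof.
apply/mnm_lepP/subsetP => [le i iS|sub i].
  by have := le i; rewrite mnmE iS inE lt0n.
by rewrite mnmE; case: (boolP (i \in S)) => // /sub; rewrite inE lt0n.
Qed.

Lemma mdeg_set_mnm S : mdeg (set_mnm S) = #|S|.
Proof.
rewrite mdegE -sum1_card [RHS]big_mkcond; apply: eq_bigr => i _.
by rewrite mnmE; case: (i \in S).
Qed.

Lemma mcoeff_mulX (p : R) u e :
  (p * 'X_[u])@_e = if (u <= e)%MM then p@_(e - u) else 0.
Proof.
case: ifP => [le|/negbT le].
  by rewrite -{1}(submK le) addmC mcoeffMX.
apply/memN_msupp_eq0; apply: contra le.
rewrite (perm_mem (msuppMX p u)) => /mapP[m _ ->].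
by apply/mnm_lepP=> i; rewrite mnmDE leq_addr.
Qed.

Section Component.
Variables (m : nat) (lab : 'I_m -> {set 'I_n}).
Implicit Types (v w : 'rV[R]_m).

(* The part of multidegree a of v, when the basis vector b has degree lab b. *)
Definition component a v : 'rV[K]_m :=
  \row_b if lab b \subset mnm_supp a then (v 0 b)@_(a - set_mnm (lab b)) else 0.

Lemma component_supported a v : supported lab (mnm_supp a) (component a v).
Proof. by move=> b; rewrite mxE; case: ifP; rewrite ?eqxx. Qed.

Lemma component_inj v w : (forall a, component a v = component a w) -> v = w.
Proof.
move=> vw; apply/rowP=> b; apply/mpolyP=> e.
have /rowP/(_ b) := vw (e + set_mnm (lab b))%MM.
by rewrite !mxE -set_mnm_le addmK; case: mnm_lepP => // -[] i; rewrite mnmDE leq_addl.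
Qed.

Lemma component0 a : component a 0 = 0.
Proof. by apply/rowP=> b; rewrite !mxE mcoeff0 if_same. Qed.

Lemma component_fin v : exists2 r : seq 'X_{1..n}, uniq r &
  forall a, a \notin r -> component a v = 0.
Proof.
exists (undup (flatten
  [seq [seq (e + set_mnm (lab b))%MM | e <- msupp (v 0 b)] | b <- enum 'I_m])).
  exact: undup_uniq.
move=> a; rewrite mem_undup => /flattenP ar; apply/rowP=> b; rewrite !mxE.
case: ifP => // ba; apply/memN_msupp_eq0/negP=> mb; case: ar.
exists [seq (e + set_mnm (lab b))%MM | e <- msupp (v 0 b)].
  by apply/mapP; exists b; rewrite ?mem_enum.
by apply/mapP; exists (a - set_mnm (lab b))%MM; rewrite ?submK ?set_mnm_le.
Qed.

Lemma component_synth (c : 'X_{1..n} -> 'rV[K]_m) (r : seq 'X_{1..n}) : uniq r ->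
    (forall a, a \notin r -> c a = 0) ->
    (forall a, supported lab (mnm_supp a) (c a)) ->
  exists w, forall a, component a w = c a.
Proof.
move=> ur cr cS.
exists (\row_b \sum_(a <- r | lab b \subset mnm_supp a)
  c a 0 b *: 'X_[a - set_mnm (lab b)]).
move=> a; apply/rowP=> b; rewrite !mxE; case: ifP => [ba|]; last first.
  by move/negP; case: (eqVneq (c a 0 b) 0) => [->|/cS].
rewrite raddf_sum /=.
transitivity (\sum_(a' <- r | a' == a) c a 0 b); last first.
  case: (boolP (a \in r)) => ar; first by rewrite -big_filter filter_pred1_uniq // big_seq1.
  by rewrite cr // mxE big1.
rewrite big_mkcond [RHS]big_mkcond; apply: eq_bigr => a' _.
case: (eqVneq a' a) => [->|ne]; first by rewrite ba mcoeffZ mcoeffX eqxx mulr1.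
case: ifP => // ba'; rewrite mcoeffZ mcoeffX; case: eqP; rewrite ?mulr0 // => E.
case/eqP: ne; rewrite -set_mnm_le in ba; rewrite -set_mnm_le in ba'.
by rewrite -(submK ba) -(submK ba') E.
Qed.

End Component.

Section Hom.
Variables (p m : nat) (laba : 'I_p -> {set 'I_n}) (labb : 'I_m -> {set 'I_n}).
Variable D : 'M[K]_(p, m).

Definition hom_mx : 'M[R]_(p, m) :=
  \matrix_(c, b) (D c b *: 'X_[set_mnm (laba c :\: labb b)]).

Hypothesis D_lab : forall c b, D c b != 0 -> labb b \subset laba c.

Lemma component_hom a v : component labb a (v *m hom_mx) = component laba a v *m D.
Proof.
apply/rowP=> b; rewrite [RHS]mxE [LHS]mxE; case: ifP => ba; last first.
  rewrite big1 // => c _; rewrite mxE; case: (eqVneq (D c b) 0) => [->|/D_lab bc].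
    by rewrite mulr0.
  by case: ifP => [/(subset_trans bc)|]; rewrite ?ba ?mul0r.
rewrite mxE raddf_sum; apply: eq_bigr => c _ /=; rewrite !mxE.
case: (eqVneq (D c b) 0) => [->|/D_lab bc]; first by rewrite scale0r !mulr0 mcoeff0.
rewrite -scalerAr mcoeffZ mcoeff_mulX mulrC.
have sub : (set_mnm (laba c :\: labb b) + set_mnm (labb b) = set_mnm (laba c))%MM.
  apply/mnmP=> i; rewrite mnmDE !mnmE inE; case: (boolP (i \in labb b)) => //= ib.
    by rewrite (subsetP bc).
  by rewrite addn0.
have <- : (set_mnm (laba c :\: labb b) <= a - set_mnm (labb b))%MM =
    (laba c \subset mnm_supp a).
  rewrite -set_mnm_le -sub; rewrite -set_mnm_le in ba.
  apply/mnm_lepP/mnm_lepP=> le i; have := le i; have /mnm_lepP/(_ i) := ba;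
    rewrite !mnmDE !mnmBE => lei; by rewrite leq_subRL // addnC.
by case: ifP => // _; rewrite submDA addmC sub.
Qed.

(** The equation splits into one linear system per multidegree. Only finitely many have a nonzero
    right-hand side, so the solutions chosen there assemble into polynomials. *)
Lemma hom_onto (v : 'rV[R]_m) :
    (forall a, exists2 w, supported laba (mnm_supp a) w & w *m D = component labb a v) ->
  exists w, v = w *m hom_mx.
Proof.
move=> ex; have [r ur rv] := component_fin labb v.
have ex' a : exists w : 'rV[K]_p, (w *m D == component labb a v) &&
    [forall b, (w 0 b != 0) ==> (laba b \subset mnm_supp a)].
  have [w wS wv] := ex a; exists w; rewrite wv eqxx; apply/forallP=> b.
  by apply/implyP=> /wS.
pose c a := if a \in r then xchoose (ex' a) else 0.
have cP a : supported laba (mnm_supp a) (c a) /\ c a *m D = component labb a v.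
  rewrite /c; case: (boolP (a \in r)) => ar; last first.
    by rewrite rv // mul0mx; split=> // b; rewrite mxE eqxx.
  have /andP[/eqP-> /forallP sup] := xchooseP (ex' a).
  by split=> // b nz; have := sup b; rewrite nz.
have [||w wc] := @component_synth _ laba c _ ur.
- by move=> a ar; rewrite /c (negbTE ar).
- by move=> a; case: (cP a).
exists w; apply: (@component_inj _ labb) => a.
by rewrite component_hom wc; case: (cP a).
Qed.

End Hom.

End Homogenization.

(** * The minimal resolution of an edge ideal and its regularity *)

Section EdgeResolution.
Local Open Scope ring_scope.

Variables (n : nat) (K : fieldType) (G : sgraph n).
Notation R := {mpoly K[n]}.
Implicit Types (S T : {set 'I_n}).

Lemma independent0 : independent G set0.
Proof. by apply/forall_inP=> x; rewrite inE. Qed.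

Lemma independentS S T : S \subset T -> independent G T -> independent G S.
Proof.
move=> /subsetP ST /forall_inP iT; apply/forall_inP=> x /ST /iT /forall_inP xT.
by apply/forall_inP=> y /ST; apply: xT.
Qed.

(** Membership in a monomial ideal is decided monomial by monomial, and a monomial lies in the edge
    ideal exactly when its support contains an edge. *)
Lemma edge_ideal_mcoeff (p : R) :
  edge_ideal G p <-> forall e, independent G (mnm_supp e) -> p@_e = 0.
Proof.
have XX i j : 'X_i * 'X_j = 'X_[U_(i) + U_(j)] :> R by rewrite mpolyXD.
split=> [[c ->] e ind|p0].
  rewrite raddf_sum big1 //= => i _; rewrite raddf_sum big1 //= => j ij.
  rewrite XX mcoeff_mulX; case: mnm_lepP => // le.
  have /forall_inP/(_ i) : independent G (mnm_supp e) by [].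
  rewrite inE -lt0n (leq_trans _ (le i)) ?mnmDE ?mnm1E ?eqxx //.
  move=> /(_ isT)/forall_inP/(_ j).
  by rewrite inE -lt0n (leq_trans _ (le j)) ?mnmDE ?mnm1E ?eqxx ?addn1 // ij => /(_ isT).
rewrite (mpolyE p) big_seq; elim/big_ind: _ => [|q r [c ->] [d ->]|e].
- exists (fun _ _ => 0); rewrite big1 // => i _; rewrite big1 // => j _.
  by rewrite mul0r.
- exists (fun i j => c i j + d i j); rewrite -big_split; apply: eq_bigr => i _.
  by rewrite -big_split; apply: eq_bigr => j _; rewrite mulrDl.
rewrite mcoeff_msupp => nz.
have /forall_inPn[i iS /forall_inPn[j jS]] : ~~ independent G (mnm_supp e).
  by apply: contra nz => /p0 ->.
rewrite negbK => ij; move: iS jS; rewrite !inE => ie je.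
have le : (U_(i) + U_(j) <= e)%MM.
  apply/mnm_lepP=> k; rewrite mnmDE !mnm1E.
  case: (eqVneq i k) ij => [<-|_] ij; last by case: (eqVneq j k) => [<-|//]; rewrite lt0n.
  case: (eqVneq j i) ij => [->|_ _]; first by rewrite adj_irr.
  by rewrite lt0n.
exists (fun i' j' =>
  if (i' == i) && (j' == j) then p@_e *: 'X_[e - (U_(i) + U_(j))] else 0).
rewrite (bigD1 i) //= [X in _ + X]big1 ?addr0 => [|k /negbTE ki]; last first.
  by rewrite big1 // => l _; rewrite ki mul0r.
rewrite (bigD1 j) //= !eqxx /= big1 ?addr0 => [|k /andP[_ /negbTE kj]]; last first.
  by rewrite kj mul0r.
by rewrite XX -scalerAl -mpolyXD submK.
Qed.

Let st i := stages K (independent G) i.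
Let inv i : stage_inv (st i) := stages_inv K independent0 independentS i.

Definition edge_diff i : 'M[R]_(rk (st i.+1), rk (st i)) :=
  hom_mx (lab (s := st i.+1)) (lab (s := st i)) (gen_mx (st i)).

Definition edge_seq : free_seq K n :=
  @FreeSeq K n (fun i => rk (st i)) (fun i b => #|lab (s := st i) b|) edge_diff
    (const_mx 1).

Lemma edge_diff_lab i c b :
  gen_mx (st i) c b != 0 -> lab (s := st i) b \proper lab (s := st i.+1) c.
Proof. exact: gen_mx_lab. Qed.

Lemma edge_diff_sub i c b :
  gen_mx (st i) c b != 0 -> lab (s := st i) b \subset lab (s := st i.+1) c.
Proof. by move/edge_diff_lab/proper_sub. Qed.

Lemma edge_diff_onto i (v : 'rV[R]_(rk (st i))) :
    (forall e, (component (lab (s := st i)) e v <= syz (st i) (mnm_supp e))%MS) <->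
  exists w, v = w *m edge_diff i.
Proof.
split=> [vZ|[w ->] e].
  apply: (hom_onto (@edge_diff_sub i)) => e.
  by have [w wS wE] := gen_mx_onto (vZ e); exists w.
rewrite component_hom; last exact: edge_diff_sub.
by apply: gen_mx_sub => //; apply: component_supported.
Qed.

(** Kernels and images are compared one multidegree at a time through [edge_diff_onto]; minimality
    follows from the strict growth of labels. *)
Lemma edge_seq_resolution : minimal_graded_free_resolution (edge_ideal G) edge_seq.
Proof.
split=> /=.
- split=> [b|i c b]; first by rewrite mxE /= cards0 dhomog1.
  rewrite /homog_sub mxE; case: (eqVneq (gen_mx (st i) c b) 0) => [->|/edge_diff_sub bc].
    by rewrite scale0r eqxx dhomog0 if_same.
  rewrite subset_leq_card //; apply: dhomogZ; rewrite dhomogX.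
  by apply/eqP; rewrite -[LHS]/(mdeg _) mdeg_set_mnm cardsD (setIidPr bc).
- move=> p; exists (const_mx p); rewrite mxE big_ord1 !mxE mulr1 subrr.
  by apply/edge_ideal_mcoeff=> e _; rewrite mcoeff0.
- move=> v; apply: iff_trans (@edge_diff_onto 0 v).
  rewrite mxE big_ord1 mxE mulr1 edge_ideal_mcoeff.
  have compE e : component (fun=> set0) e v = const_mx (v 0 0)@_e.
    apply/rowP=> b; rewrite !mxE sub0set ord1; congr (_@_ _).
    by apply/mnmP=> i; rewrite mnmBE mnmE inE subn0.
  split=> v0 e; have := v0 e; rewrite /= compE.
    case: ifP => [_ /(_ isT) ->|_ _]; last exact: submx1.
    by rewrite submx0; apply/eqP/rowP=> b; rewrite !mxE.
  by move=> /[swap] ->; rewrite submx0 => /eqP/rowP/(_ 0); rewrite !mxE.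
- move=> i v; apply: iff_trans (@edge_diff_onto i.+1 v).
  have compE e : component (lab (s := st i)) e (v *m edge_diff i) =
      component (lab (s := st i.+1)) e v *m gen_mx (st i).
    by apply: component_hom; apply: edge_diff_sub.
  split=> [v0 e|vZ].
    apply/next_stage_syzP; split; last exact: component_supported.
    by have := compE e; rewrite v0 component0 => <-.
  apply: (@component_inj _ _ _ (lab (s := st i))) => e; rewrite compE component0.
  by have /next_stage_syzP[] := vZ e.
move=> i c b; rewrite mxE mcoeffZ mcoeffX.
case: (eqVneq (gen_mx (st i) c b) 0) => [->|/edge_diff_lab/properP[_ [x xc xb]]].
  by rewrite mul0r.
case: eqP => [/mnmP/(_ x)|]; last by rewrite mulr0.
by rewrite mnmE mnm0E inE xb xc.
Qed.

(** A generator labelled [T] in homological degree [i + 1] has degree [#|T|] and detects cohomology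
    at faces with [q = #|T| - (i + 1)] vertices. This [q] is also its contribution to the
    regularity. *)
Lemma is_reg_cochain r :
    (forall T q, (r < q)%N -> face_exact (independent G) 'rV[K]_1 T q) ->
    (exists2 T : {set 'I_n}, (r < #|T|)%N & ~ face_exact (independent G) 'rV[K]_1 T r) ->
  is_reg K G r.
Proof.
move=> up [T rT nex]; exists edge_seq; split; first exact: edge_seq_resolution.
  exists (#|T| - r.+1).+1.
  have TE : #|T| = (r + (#|T| - r.+1)).+1 by rewrite -addSn subnKC.
  rewrite /betti -lt0n card_gt0; apply/eqP=> E; apply: nex.
  apply/(stages_gens _ independent0 independentS TE) => c.
  apply: contraT; rewrite negbK => /eqP/(congr1 (fun S : {set 'I_n} => #|S|)) cardT.
  have : c \in set0.
    rewrite -E inE; apply/eqP; transitivity #|T|; first exact: cardT.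
    by rewrite {1}TE addSn addnC.
  by rewrite inE.
(* In homological degree 0 the only generator has degree 0. *)
case=> [|i] j; rewrite /betti -lt0n card_gt0 => /set0Pn[c]; rewrite inE => /eqP <- /=.
  by rewrite cards0.
rewrite leqNgt; apply/negP=> lt.
set S := gen_lab c in lt *.
have TE : #|S| = (#|S| - i.+1 + i).+1.
  by rewrite -addnS subnK // ltnW // (leq_ltn_trans _ lt) // leq_addr.
have ex : face_exact (independent G) 'rV[K]_1 S (#|S| - i.+1).
  by apply: up; rewrite ltn_subRL.
have /(_ c) := (stages_gens K independent0 independentS TE).1 ex.
by rewrite eqxx.
Qed.

End EdgeResolution.

(** * Cohomology of unions, joins and suspensions *)

Section Cohomology.
Local Open Scope ring_scope.

Variables (n : nat) (K : fieldType) (E : lmodType K) (face : pred {set 'I_n}).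
Hypothesis faceS : forall S T : {set 'I_n}, S \subset T -> face T -> face S.
Implicit Types (a b s t : 'I_n) (S R U T P Q : {set 'I_n}) (z y : {set 'I_n} -> E).

Lemma face_exactP T q :
  face_exact (K := K) face E T q <->
  (forall z, (forall S, S \subset T -> #|S| = q.+1 -> face S -> cob z S = 0) ->
   exists y, forall S, S \subset T -> #|S| = q -> face S -> z S = cob y S).
Proof.
split=> ex z => [zc|_ zc].
  have [//|y _ yE] := ex z (fun _ => I).
  by exists y => S ST Sq fS; apply/eqP; rewrite -subr_eq0 yE.
have [y yE] := ex z zc; exists y => // S ST Sq fS.
by rewrite yE ?subrr.
Qed.

Lemma face_exact_card T q : (#|T| < q)%N -> face_exact (K := K) face E T q.
Proof.
move=> Tq; apply/face_exactP=> z _; exists z => S /subset_leq_card.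
by move=> /leq_ltn_trans/(_ Tq) + Sq; rewrite Sq ltnn.
Qed.

(** Primitives on the two parts are glued. As [1 < q], a face minus a vertex is nonempty and still
    shows in which part it lies. *)
Lemma face_exact_union P Q T q : (1 < q)%N -> [disjoint P & Q] ->
    P \subset T -> Q \subset T ->
    (forall S, S \subset T -> face S -> (S \subset P) || (S \subset Q)) ->
    face_exact (K := K) face E P q -> face_exact (K := K) face E Q q ->
  face_exact (K := K) face E T q.
Proof.
move=> q1 dPQ PT QT cov /face_exactP exP /face_exactP exQ.
apply/face_exactP=> z zc.
have [S SP|y1 y1E] := exP z; first by apply: zc; apply: subset_trans PT.
have [S SQ|y2 y2E] := exQ z; first by apply: zc; apply: subset_trans QT.
exists (fun S => if S \subset P then y1 S else y2 S) => S ST Sq fS.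
have [SP|SQ] := orP (cov S ST fS).
  by rewrite y1E //; apply: eq_cob => s sS; rewrite (subset_trans (subD1set _ _) SP).
rewrite y2E //; apply: eq_cob => s sS; case: ifP => // SsP.
have : S :\ s == set0.
  rewrite -subset0 -(setIid (S :\ s)); move: dPQ; rewrite -setI_eq0 => /eqP <-.
  by rewrite setISS // (subset_trans (subD1set _ _) SQ).
by rewrite -cards_eq0; move: q1; rewrite -Sq (cardsD1 s S) sS add1n ltnS lt0n => /negbTE->.
Qed.

(** A Leibniz rule: since [P] precedes [Q], vertices of [S'] pass all of [S] and acquire the sign,
    while those of [S] pass none of [S']. *)
Lemma cob_join P Q z S S' : (forall s t, s \in P -> t \in Q -> (s < t)%N) ->
    S \subset P -> S' \subset Q ->
  cob z (S :|: S') = cob (fun R => z (R :|: S')) S +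
    (-1) ^+ #|S| *: cob (fun R => z (S :|: R)) S'.
Proof.
move=> PQ /subsetP SP /subsetP SQ.
have dis s : s \in S -> s \in S' = false.
  by move=> /SP sP; apply/negP=> /SQ sQ; have := PQ _ _ sP sQ; rewrite ltnn.
have sgnl s : s \in S -> sgn K s (S :|: S') = sgn K s S.
  move=> sS; congr (_ ^+ _); apply: eq_card => t; rewrite !inE.
  case: (boolP (t \in S')) => [/SQ tQ|]; last by rewrite orbF.
  by rewrite [(t < s)%N]ltnNge (ltnW (PQ _ _ (SP _ sS) tQ)) !andbF.
have sgnr t : t \in S' -> sgn K t (S :|: S') = (-1) ^+ #|S| * sgn K t S'.
  move=> tS; rewrite /sgn -exprD; congr (_ ^+ _).
  have -> : [set u in S :|: S' | (u < t)%N] = S :|: [set u in S' | (u < t)%N].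
    apply/setP=> u; rewrite !inE; case: (boolP (u \in S)) => //= uS.
    by rewrite (PQ _ _ (SP _ uS) (SQ _ tS)).
  have I0 : S :&: [set u in S' | (u < t)%N] = set0.
    by apply/setP=> u; rewrite !inE; case: (boolP (u \in S)) => //= /dis ->.
  by rewrite cardsU I0 cards0 subn0.
have dSS : [disjoint S & S'].
  by rewrite disjoints_subset; apply/subsetP=> s /dis; rewrite inE => ->.
rewrite /cob (eq_bigl (fun s => s \in [predU S & S'])) => [|s]; last by rewrite !inE.
rewrite bigU //=.
rewrite scaler_sumr; congr (_ + _); apply: eq_bigr => s sS.
  rewrite sgnl //; congr (_ *: z _).
  by apply/setP=> t; rewrite !inE; case: eqVneq => //= ->; rewrite dis.
rewrite sgnr // scalerA; congr (_ *: z _).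
apply/setP=> t; rewrite !inE; case: eqVneq => //= ->; rewrite orbF.
by apply/esym/negP=> /dis; rewrite sS.
Qed.

Lemma cob_U1 z a P S : (forall t, t \in P -> (a < t)%N) -> S \subset P ->
  cob z (a |: S) = z S - cob (fun R => z (a |: R)) S.
Proof.
move=> aP SP; rewrite (@cob_join [set a] P) // => [|s t /set1P ->]; last exact: aP.
rewrite cards1 expr1 scaleN1r; congr (_ - _).
have a0 : [set t in [set a] | (t < a)%N] = set0.
  by apply/setP=> t; rewrite !inE; case: eqP => //= ->; rewrite ltnn.
by rewrite /cob big_set1 setDv set0U /sgn a0 cards0 expr0 scale1r.
Qed.

(** Suspension is injective on cohomology: put [z] on the faces containing [a] and take a primitive
    [y]. Comparing its equations at [a |: S] and [b |: S] eliminates [y S] and leaves a primitive of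
    [z]. *)
Lemma face_exact_suspension a b P q : (a < b)%N ->
    (forall t, t \in P -> (b < t)%N) ->
    (forall S, a \in S -> b \in S -> ~~ face S) ->
    (forall S, S \subset P -> face S -> face (a |: S) /\ face (b |: S)) ->
  face_exact (K := K) face E (a |: (b |: P)) q.+1 -> face_exact (K := K) face E P q.
Proof.
move=> ab bP abF addF /face_exactP ex; apply/face_exactP=> z zc.
have aP t : t \in P -> (a < t)%N by move=> /bP; apply: ltn_trans.
have aNP : a \notin P by apply/negP=> /aP; rewrite ltnn.
have bNP : b \notin P by apply/negP=> /bP; rewrite ltnn.
have ba : b != a by rewrite -val_eqE /= gtn_eqF.
pose z' S := if a \in S then z (S :\ a) else 0.
have [U UT Uq fU|y yE] := ex z'.
  case: (boolP (a \in U)) => aU; last first.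
    rewrite -[RHS](cob0 E U); apply: eq_cob => s _.
    by rewrite /z' !inE (negbTE aU) andbF.
  have bU : b \notin U by apply: contraL fU; apply: abF.
  have UP : U :\ a \subset P.
    apply/subsetP=> t; rewrite !inE => /andP[ta tU]; have := subsetP UT t tU.
    rewrite !inE (negbTE ta) /= => /predU1P[tb|//].
    by rewrite -tb tU in bU.
  rewrite -(setD1K aU) (cob_U1 _ aP UP) {1}/z' !inE eqxx sub0r.
  apply/eqP; rewrite oppr_eq0; apply/eqP; rewrite -[RHS](zc (U :\ a)) //.
  - apply: eq_cob => s sU; rewrite /z' setU11 setU1K // !inE.
    by rewrite eqxx andbF.
  - by move: Uq; rewrite (cardsD1 a) aU => -[].
  - by apply: faceS fU; apply: subD1set.
exists (fun R => y (b |: R) - y (a |: R)) => S SP Sq fS.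
have [faS fbS] := addF S SP fS.
have aS : a \notin S by apply: contra aNP; apply: (subsetP SP).
have bS : b \notin S by apply: contra bNP; apply: (subsetP SP).
have := yE (a |: S); rewrite cardsU1 aS Sq => /(_ _ erefl faS).
have := yE (b |: S); rewrite cardsU1 bS Sq => /(_ _ erefl fbS).
rewrite (cob_U1 _ aP SP) (cob_U1 _ bP SP) /z' !inE eqxx [a == b]eq_sym.
rewrite (negbTE ba) (negbTE aS) /=.
rewrite setU1K // => /(_ _)/esym/eqP; rewrite subr_eq0 => yb ya.
rewrite ya; first last.
  by rewrite setUS // subsetU // SP orbT.
by rewrite cobB -(eqP (yb _)) // subsetU // setUS ?orbT.
Qed.

Section Join.
(** [P] carries faces of dimension at most [d], and [L R] is a cochain whose coboundary is the
    indicator of the top face [R]. This splitting kills the top cohomology of [P] and lowers the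
    bound for the join from [b + d + 1] to [b + d]. *)
Variables (P Q : {set 'I_n}) (d b : nat) (L : {set 'I_n} -> {set 'I_n} -> K).
Hypothesis ltPQ : forall s t, s \in P -> t \in Q -> (s < t)%N.
Hypothesis faceU : forall S S', S \subset P -> S' \subset Q ->
  face S -> face S' -> face (S :|: S').
Hypothesis face_dim : forall S, S \subset P -> face S -> (#|S| <= d.+1)%N.
Hypothesis L_contraction : forall S R, S \subset P -> face S -> #|S| = d.+1 ->
  R \subset P -> face R -> #|R| = d.+1 ->
  \sum_(s in S) sgn K s S * L R (S :\ s) = (S == R)%:R.
Hypothesis exQ : forall q, (b < q)%N -> face_exact (K := K) face E Q q.

Let meetP S S' : S \subset P -> S' \subset Q -> (S :|: S') :&: P = S.
Proof.
move=> /subsetP SP /subsetP SQ; apply/setP=> t; rewrite !inE.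
case: (boolP (t \in S)) => [/SP -> //|_] /=; apply/negP=> /andP[/SQ tQ tP].
by have := ltPQ tP tQ; rewrite ltnn.
Qed.

Let meetQ S S' : S \subset P -> S' \subset Q -> (S :|: S') :&: Q = S'.
Proof.
move=> /subsetP SP /subsetP SQ; apply/setP=> t; rewrite !inE.
case: (boolP (t \in S')) => [/SQ -> //|_] /=; first by rewrite orbT.
by rewrite orbF; apply/negP=> /andP[/SP tP tQ]; have := ltPQ tP tQ; rewrite ltnn.
Qed.

Let cardPQ S S' : S \subset P -> S' \subset Q -> #|S :|: S'| = (#|S| + #|S'|)%N.
Proof.
move=> SP SQ; rewrite cardsU [X in (_ - X)%N](_ : _ = 0%N) ?subn0 //.
apply/eqP; rewrite cards_eq0 -(meetQ SP SQ) setICA.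
apply/eqP/setP=> t; rewrite !inE; apply/negP=> /and3P[_ /(subsetP SP) tP tQ].
by have := ltPQ tP tQ; rewrite ltnn.
Qed.

(* The component of z on faces with k vertices in P is a family of cocycles on Q
   once the lower components vanish. *)
Lemma face_exact_join_low q z k : (b + d < q)%N -> (k <= d.+1)%N ->
    (forall S, S \subset P :|: Q -> #|S| = q.+1 -> face S -> cob z S = 0) ->
  exists y, forall S S', S \subset P -> S' \subset Q -> (#|S| < k)%N ->
    (#|S| + #|S'| = q)%N -> face (S :|: S') -> z (S :|: S') = cob y (S :|: S').
Proof.
move=> qb + zc; elim: k => [|k IHk] kd; first by exists z.
have [y yE] := IHk (ltnW kd) => {IHk}.
pose z1 S := z S - cob y S.
have z1c S : S \subset P :|: Q -> #|S| = q.+1 -> face S -> cob z1 S = 0.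
  by move=> ST Sq fS; rewrite cobB cobK subr0 zc.
have z1k S S' : S \subset P -> S' \subset Q -> (#|S| < k)%N ->
    (#|S| + #|S'| = q)%N -> face (S :|: S') -> z1 (S :|: S') = 0.
  by move=> *; rewrite /z1 -yE ?subrr.
have ex S : exists w : {set 'I_n} -> E, S \subset P -> face S -> #|S| = k ->
    forall S', S' \subset Q -> (k + #|S'| = q)%N -> face S' ->
    z1 (S :|: S') = cob w S'.
  case: (boolP (S \subset P)) => [SP|]; last by exists z.
  case: (boolP (face S)) => [fS|]; last by exists z.
  case: (eqVneq #|S| k) => [Sk|/eqP]; last by exists z.
  have bq : (b < q - k)%N by lia.
  have [R RQ Rq fR|w wE] := (face_exactP Q (q - k)).1 (exQ bq) (fun R => z1 (S :|: R)).
    have := z1c (S :|: R); rewrite setUSS // cardPQ // Sk Rq faceU //.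
    move=> /(_ isT); rewrite addnS subnKC; last by lia.
    move=> /(_ erefl isT); rewrite (cob_join _ ltPQ SP RQ) [X in X + _]big1 ?add0r.
      by move=> /eqP; rewrite scaler_eq0 signr_eq0 => /eqP.
    move=> s sS; rewrite z1k ?scaler0 //.
    - by rewrite (subset_trans (subD1set _ _)).
    - by rewrite -Sk [X in (_ < X)%N](cardsD1 s) sS.
    - move: Sk; rewrite (cardsD1 s) sS Rq; lia.
    apply: faceS (faceU SP RQ fS fR); apply: setSU; exact: subD1set.
  by exists w => _ _ _ S' SQ Sq fS'; apply: wE => //; lia.
have [w wE] := fin_all_exists ex.
(* The sign cancels the one that [cob_join] puts on the [Q]-part. *)
pose y' S := if #|S :&: P| == k then (-1) ^+ k *: w (S :&: P) (S :&: Q) else 0.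
have y'E S S' : S \subset P -> S' \subset Q ->
    y' (S :|: S') = if #|S| == k then (-1) ^+ k *: w S S' else 0.
  by move=> SP SQ; rewrite /y' meetP ?meetQ.
exists (fun S => y S + y' S) => S S' SP SQ Sk Sq fS.
have -> : cob (fun S => y S + y' S) (S :|: S') = cob y (S :|: S') + cob y' (S :|: S').
  by rewrite /cob -big_split; apply: eq_bigr => s _; rewrite scalerDr.
apply/eqP; rewrite addrC -subr_eq -/(z1 _); apply/eqP.
rewrite (cob_join _ ltPQ SP SQ) [X in X + _]big1 ?add0r => [|s sS]; last first.
  rewrite y'E ?(subset_trans (subD1set _ _)) //.
  by move: Sk; rewrite (cardsD1 s) sS => Sk; rewrite ltn_eqF ?scaler0 //; lia.
case: (eqVneq #|S| k) => [Ek|nk]; last first.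
  rewrite z1k ?(ltn_neqAle, nk) // /cob big1 ?scaler0 // => s sS.
  by rewrite y'E ?(negbTE nk) ?scaler0 // (subset_trans (subD1set _ _)).
rewrite (wE S SP _ Ek S' SQ) //; first last.
- by apply: faceS fS; apply: subsetUr.
- by rewrite -Ek.
- by apply: faceS fS; apply: subsetUl.
rewrite /cob scaler_sumr; apply: eq_bigr => s sS.
rewrite y'E ?(subset_trans (subD1set _ _)) // Ek eqxx !scalerA.
by rewrite mulrAC -expr2 sqrr_sign mul1r.
Qed.

Lemma face_exact_join q : (b + d < q)%N -> face_exact (K := K) face E (P :|: Q) q.
Proof.
move=> qb; apply/face_exactP=> z zc.
have [y yE] := face_exact_join_low qb (leqnn _) zc.
pose z1 S := z S - cob y S.
have z1c S : S \subset P :|: Q -> #|S| = q.+1 -> face S -> cob z1 S = 0.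
  by move=> ST Sq fS; rewrite cobB cobK subr0 zc.
have z1k S S' : S \subset P -> S' \subset Q -> (#|S| < d.+1)%N ->
    (#|S| + #|S'| = q)%N -> face (S :|: S') -> z1 (S :|: S') = 0.
  by move=> *; rewrite /z1 -yE ?subrr.
pose top := [pred R : {set 'I_n} | [&& R \subset P, face R & #|R| == d.+1]].
(* The remaining cocycle [z1] lives on faces with [d + 1] vertices in [P]; applying [L] in the
   [P]-direction gives its primitive, supported on faces with [d] vertices in [P]. *)
pose y' S := if #|S :&: P| == d then
  \sum_(R | top R) L R (S :&: P) *: z1 (R :|: (S :&: Q)) else 0.
have y'E S S' : S \subset P -> S' \subset Q -> y' (S :|: S') =
    if #|S| == d then \sum_(R | top R) L R S *: z1 (R :|: S') else 0.
  by move=> SP SQ; rewrite /y' meetP ?meetQ.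
exists (fun S => y S + y' S) => U UT Uq fU.
have -> : cob (fun S => y S + y' S) U = cob y U + cob y' U.
  by rewrite /cob -big_split; apply: eq_bigr => s _; rewrite scalerDr.
apply/eqP; rewrite addrC -subr_eq -/(z1 _); apply/eqP.
pose S := U :&: P; pose S' := U :&: Q.
have SP : S \subset P by apply: subsetIr.
have SQ : S' \subset Q by apply: subsetIr.
have UE : U = S :|: S' by rewrite -setIUr; apply/esym/setIidPl.
have Sq : (#|S| + #|S'| = q)%N by rewrite -cardPQ // -UE.
have fS : face S by apply: faceS fU; apply: subsetIl.
have fS' : face S' by apply: faceS fU; apply: subsetIl.
rewrite UE (cob_join _ ltPQ SP SQ).
have Sd := face_dim SP fS; move: Sd; rewrite leq_eqVlt => /predU1P[Sd|Sd].
  rewrite [X in _ *: X]big1 ?scaler0 ?addr0 => [|s sS]; last first.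
    rewrite y'E ?(subset_trans (subD1set _ _)) // Sd.
    by rewrite gtn_eqF ?scaler0.
  have topS : top S by rewrite /= SP fS Sd eqxx.
  transitivity (\sum_(R | top R) (S == R)%:R *: z1 (R :|: S')).
    rewrite (bigD1 S) //= eqxx scale1r big1 ?addr0 // => R /andP[_ RS].
    by rewrite eq_sym (negbTE RS) scale0r.
  transitivity (\sum_(s in S) \sum_(R | top R)
    (sgn K s S * L R (S :\ s)) *: z1 (R :|: S')).
    rewrite exchange_big; apply: eq_bigr => R /and3P[RP fR /eqP Rd].
    by rewrite -scaler_suml L_contraction.
  apply: eq_bigr => s sS; rewrite y'E ?(subset_trans (subD1set _ _)) //.
  move: Sd; rewrite (cardsD1 s) sS add1n => -[->]; rewrite eqxx scaler_sumr.
  by apply: eq_bigr => R _; rewrite scalerA.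
rewrite -{1}UE UE z1k -?UE // /cob [X in X + _]big1 ?add0r => [|s sS]; last first.
  rewrite y'E ?(subset_trans (subD1set _ _)) //.
  by move: Sd; rewrite (cardsD1 s) sS => Sd; rewrite ltn_eqF ?scaler0 //; lia.
apply/esym; case: (eqVneq #|S| d) => [Ed|nd]; last first.
  rewrite big1 ?scaler0 // => s sS.
  by rewrite y'E ?(negbTE nd) ?scaler0 // (subset_trans (subD1set _ _)).
(* For [d] vertices in [P] the coboundary of [y'] must vanish: each slice of [z1] over a top face
   [R] is a cocycle on [Q], because the lower slices are zero. *)
transitivity ((-1) ^+ #|S| *: \sum_(R | top R) L R S *: cob (fun S' => z1 (R :|: S')) S').
  congr (_ *: _); rewrite /cob.
  under [RHS]eq_bigr => R _ do rewrite scaler_sumr.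
  rewrite [RHS]exchange_big; apply: eq_bigr => s sS.
  rewrite y'E ?(subset_trans (subD1set _ _)) // Ed eqxx scaler_sumr.
  by apply: eq_bigr => R _; rewrite !scalerA mulrC.
rewrite big1 ?scaler0 // => R /and3P[RP fR /eqP Rd].
have := z1c (R :|: S'); rewrite setUSS // cardPQ // Rd addSn -Ed Sq faceU //.
move=> /(_ isT erefl isT); rewrite (cob_join _ ltPQ RP SQ) [X in X + _]big1 ?add0r.
  by move=> /eqP; rewrite scaler_eq0 signr_eq0 => /eqP->; rewrite scaler0.
move=> s sR; rewrite z1k ?scaler0 //.
- by rewrite (subset_trans (subD1set _ _)).
- by move: Rd; rewrite (cardsD1 s) sR; lia.
- by move: Rd; rewrite (cardsD1 s) sR; lia.
by apply: faceS (faceU RP SQ fR fS'); apply: setSU; exact: subD1set.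
Qed.

End Join.

End Cohomology.

(** * The complex on 14 vertices *)

Section Hat.

Definition hat_edges : seq (seq nat) :=
  [:: [:: 0; 2]; [:: 0; 3]; [:: 0; 4]; [:: 0; 5]; [:: 0; 6]; [:: 0; 13];
    [:: 1; 2]; [:: 1; 3]; [:: 1; 5]; [:: 1; 11]; [:: 1; 12]; [:: 2; 4];
    [:: 2; 6]; [:: 2; 11]; [:: 2; 12]; [:: 3; 5]; [:: 3; 6]; [:: 3; 7];
    [:: 3; 10]; [:: 3; 12]; [:: 4; 5]; [:: 4; 7]; [:: 4; 8]; [:: 4; 9];
    [:: 4; 12]; [:: 4; 13]; [:: 5; 8]; [:: 5; 9]; [:: 5; 11]; [:: 6; 7];
    [:: 6; 8]; [:: 6; 11]; [:: 6; 13]; [:: 7; 8]; [:: 7; 9]; [:: 7; 10];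
    [:: 8; 11]; [:: 9; 10]; [:: 9; 11]; [:: 10; 11]; [:: 10; 12]; [:: 10; 13];
    [:: 11; 13]; [:: 12; 13]].

Definition hat_faces : seq (seq nat) :=
  [:: [:: 0; 2; 4]; [:: 0; 2; 6]; [:: 0; 3; 5]; [:: 0; 3; 6]; [:: 0; 4; 5];
    [:: 0; 4; 13]; [:: 0; 6; 13]; [:: 1; 2; 11]; [:: 1; 2; 12]; [:: 1; 3; 5];
    [:: 1; 3; 12]; [:: 1; 5; 11]; [:: 2; 4; 12]; [:: 2; 6; 11]; [:: 3; 6; 7];
    [:: 3; 7; 10]; [:: 3; 10; 12]; [:: 4; 5; 8]; [:: 4; 5; 9]; [:: 4; 7; 8];
    [:: 4; 7; 9]; [:: 4; 12; 13]; [:: 5; 8; 11]; [:: 5; 9; 11]; [:: 6; 7; 8];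
    [:: 6; 8; 11]; [:: 6; 11; 13]; [:: 7; 9; 10]; [:: 9; 10; 11];
    [:: 10; 11; 13]; [:: 10; 12; 13]].

(* Row f, indexed by hat_edges, is a cochain whose coboundary is the indicator
   function of the f-th triangle; found by integer elimination. *)
Definition hat_inverse : seq (seq int) :=
  [:: [:: 0; 0; -1; -1; 0; 0; 0; 1; 0; 0; 1; 0; 0; 0; 1; -1; 0; 0; 0; 0; 0; 0;
        0; 0; 1; 1; 0; 0; 0; 0; 0; 0; 0; 0; 0; 0; 0; 0; 0; 0; 0; 0; 0; 0];
      [:: 0; 0; 1; 1; 0; 0; 0; 0; 1; 1; 0; 1; 1; 1; 0; 1; 0; 0; 0; 0; 0; 0; 0;
        0; -1; -1; 0; 0; 0; 0; 0; 0; 0; 0; 0; 0; 0; 0; 0; 0; 0; 0; 0; 0];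
      [:: 0; 0; -1; -1; 0; 0; 0; 0; 0; 0; 0; -1; 0; 0; 0; 0; 0; 0; 0; 0; 0; 0;
        0; 0; 1; 1; 0; 0; 0; 0; 0; 0; 0; 0; 0; 0; 0; 0; 0; 0; 0; 0; 0; 0];
      [:: 0; 1; 1; 1; 0; 0; 0; 0; 0; 0; 0; 1; 0; 0; 0; 0; 0; 0; 0; 0; 0; 0; 0;
        0; -1; -1; 0; 0; 0; 0; 0; 0; 0; 0; 0; 0; 0; 0; 0; 0; 0; 0; 0; 0];
      [:: 0; 0; 1; 0; 0; 0; 0; 0; 0; 0; 0; 1; 0; 0; 0; 0; 0; 0; 0; 0; 0; 0; 0;
        0; -1; -1; 0; 0; 0; 0; 0; 0; 0; 0; 0; 0; 0; 0; 0; 0; 0; 0; 0; 0];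
      [:: 0; 0; -1; -1; 0; 0; 0; 1; 0; 0; 1; -1; 0; 0; 1; -1; 0; 0; 0; 0; 0; 0;
        0; 0; 2; 2; 0; 0; 0; 0; 0; 0; 0; 0; 0; 0; 0; 0; 0; 0; 0; 0; 0; 0];
      [:: 0; 0; 1; 1; 0; 0; 0; -1; 0; 0; 0; 1; 0; 0; 0; 1; 0; 0; 0; 1; 0; 0; 0;
        0; -1; -1; 0; 0; 0; 0; 0; 0; 1; 0; 0; 0; 0; 0; 0; 0; 1; 1; 1; 0];
      [:: 0; 0; -1; -1; 0; 0; 0; 0; -1; -1; 0; -1; 0; 0; 0; -1; 0; 0; 0; 0; 0;
        0; 0; 0; 1; 1; 0; 0; 0; 0; 0; 0; 0; 0; 0; 0; 0; 0; 0; 0; 0; 0; 0; 0];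
      [:: 0; 0; 1; 1; 0; 0; 0; -1; 0; 0; -1; 1; 0; 0; 0; 1; 0; 0; 0; 0; 0; 0; 0;
        0; -1; -1; 0; 0; 0; 0; 0; 0; 0; 0; 0; 0; 0; 0; 0; 0; 0; 0; 0; 0];
      [:: 0; 0; 1; 1; 0; 0; 0; 0; 0; 0; 0; 1; 0; 0; 0; 1; 0; 0; 0; 0; 0; 0; 0;
        0; -1; -1; 0; 0; 0; 0; 0; 0; 0; 0; 0; 0; 0; 0; 0; 0; 0; 0; 0; 0];
      [:: 0; 0; -1; -1; 0; 0; 0; 1; 0; 0; 0; -1; 0; 0; 0; -1; 0; 0; 0; 0; 0; 0;
        0; 0; 1; 1; 0; 0; 0; 0; 0; 0; 0; 0; 0; 0; 0; 0; 0; 0; 0; 0; 0; 0];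
      [:: 0; 0; 1; 1; 0; 0; 0; 0; 1; 0; 0; 1; 0; 0; 0; 1; 0; 0; 0; 0; 0; 0; 0;
        0; -1; -1; 0; 0; 0; 0; 0; 0; 0; 0; 0; 0; 0; 0; 0; 0; 0; 0; 0; 0];
      [:: 0; 0; 1; 1; 0; 0; 0; -1; 0; 0; -1; 1; 0; 0; -1; 1; 0; 0; 0; 0; 0; 0;
        0; 0; -1; -1; 0; 0; 0; 0; 0; 0; 0; 0; 0; 0; 0; 0; 0; 0; 0; 0; 0; 0];
      [:: 0; 0; -1; -1; 0; 0; 0; 0; -1; -1; 0; -1; 0; -1; 0; -1; 0; 0; 0; 0; 0;
        0; 0; 0; 1; 1; 0; 0; 0; 0; 0; 0; 0; 0; 0; 0; 0; 0; 0; 0; 0; 0; 0; 0];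
      [:: 0; -1; -1; -1; 0; 0; 0; 0; 0; 0; 0; -1; 0; 0; 0; 0; 1; 0; 0; 0; 0; 0;
        0; 0; 1; 1; 0; 0; 0; 0; 0; 0; 0; 0; 0; 0; 0; 0; 0; 0; 0; 0; 0; 0];
      [:: 0; -1; -1; -1; 0; 0; 0; 0; 0; 0; 0; -1; 0; 0; 0; 0; 1; 1; 0; 0; 0; 0;
        0; 0; 1; 1; 0; 0; 0; 0; 0; 0; 0; 0; 0; 0; 0; 0; 0; 0; 0; 0; 0; 0];
      [:: 0; 0; -1; -1; 0; 0; 0; 1; 0; 0; 0; -1; 0; 0; 0; -1; 0; 0; 0; -1; 0; 0;
        0; 0; 1; 1; 0; 0; 0; 0; 0; 0; 0; 0; 0; 0; 0; 0; 0; 0; 0; 0; 0; 0];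
      [:: 0; 1; 0; 1; 0; 0; 0; 0; 0; 0; 0; 0; 0; 0; 0; 0; -1; 0; 0; 0; 1; 1; 0;
        1; 0; 0; 0; 0; 0; 1; 0; 0; 0; -1; 0; 0; 0; 0; 0; 0; 0; 0; 0; 0];
      [:: 0; -1; -1; -1; 0; 0; 0; 0; 0; 0; 0; -1; 0; 0; 0; 0; 1; 0; 0; 0; 0; -1;
        0; -1; 1; 1; 0; 0; 0; -1; 0; 0; 0; 1; 0; 0; 0; 0; 0; 0; 0; 0; 0; 0];
      [:: 0; -1; -1; -1; 0; 0; 0; 0; 0; 0; 0; -1; 0; 0; 0; 0; 1; 0; 0; 0; 0; 0;
        0; 0; 1; 1; 0; 0; 0; -1; 0; 0; 0; 1; 0; 0; 0; 0; 0; 0; 0; 0; 0; 0];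
      [:: 0; 1; 1; 1; 0; 0; 0; 0; 0; 0; 0; 1; 0; 0; 0; 0; -1; 0; 0; 0; 0; 1; 0;
        0; -1; -1; 0; 0; 0; 1; 0; 0; 0; -1; 0; 0; 0; 0; 0; 0; 0; 0; 0; 0];
      [:: 0; 0; -1; -1; 0; 0; 0; 1; 0; 0; 1; -1; 0; 0; 1; -1; 0; 0; 0; 0; 0; 0;
        0; 0; 2; 1; 0; 0; 0; 0; 0; 0; 0; 0; 0; 0; 0; 0; 0; 0; 0; 0; 0; 0];
      [:: 0; -1; 0; -1; 0; 0; 0; 0; 0; 0; 0; 0; 0; 0; 0; 0; 1; 0; 0; 0; -1; -1;
        0; -1; 0; 0; 1; 0; 0; -1; 0; 0; 0; 1; 0; 0; 0; 0; 0; 0; 0; 0; 0; 0];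
      [:: 0; 1; 1; 1; 0; 0; 0; 0; 0; 0; 0; 1; 0; 0; 0; 0; -1; 0; 0; 0; 0; 1; 0;
        1; -1; -1; 0; 1; 0; 1; 0; 0; 0; -1; 0; 0; 0; 0; 0; 0; 0; 0; 0; 0];
      [:: 0; 1; 1; 1; 0; 0; 0; 0; 0; 0; 0; 1; 0; 0; 0; 0; -1; 0; 0; 0; 0; 0; 0;
        0; -1; -1; 0; 0; 0; 1; 0; 0; 0; 0; 0; 0; 0; 0; 0; 0; 0; 0; 0; 0];
      [:: 0; 1; 0; 1; 0; 0; 0; 0; 0; 0; 0; 0; 0; 0; 0; 0; -1; 0; 0; 0; 1; 1; 0;
        1; 0; 0; -1; 0; 0; 1; 0; 0; 0; -1; 0; 0; 1; 0; 0; 0; 0; 0; 0; 0];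
      [:: 0; 0; 1; 1; 0; 0; 0; -1; 0; 0; 0; 1; 0; 0; 0; 1; 0; 0; 0; 1; 0; 0; 0;
        0; -1; -1; 0; 0; 0; 0; 0; 0; 0; 0; 0; 0; 0; 0; 0; 0; 1; 1; 1; 0];
      [:: 0; -1; -1; -1; 0; 0; 0; 0; 0; 0; 0; -1; 0; 0; 0; 0; 1; 1; 0; 0; 0; 0;
        0; 0; 1; 1; 0; 0; 0; 0; 0; 0; 0; 0; 0; -1; 0; 0; 0; 0; 0; 0; 0; 0];
      [:: 0; 0; 1; 1; 0; 0; 0; -1; 0; 0; 0; 1; 0; 0; 0; 1; 0; 0; 0; 1; 0; 0; 0;
        0; -1; -1; 0; 0; 0; 0; 0; 0; 0; 0; 0; 0; 0; 0; 0; 1; 1; 1; 0; 0];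
      [:: 0; 0; -1; -1; 0; 0; 0; 1; 0; 0; 0; -1; 0; 0; 0; -1; 0; 0; 0; -1; 0; 0;
        0; 0; 1; 1; 0; 0; 0; 0; 0; 0; 0; 0; 0; 0; 0; 0; 0; 0; -1; -1; 0; 0];
      [:: 0; 0; 1; 1; 0; 0; 0; -1; 0; 0; 0; 1; 0; 0; 0; 1; 0; 0; 0; 1; 0; 0; 0;
        0; -1; -1; 0; 0; 0; 0; 0; 0; 0; 0; 0; 0; 0; 0; 0; 0; 1; 0; 0; 0]]%Z.

(* Adjacency in the complement of the 1-skeleton. *)
Definition hat_adj (i j : nat) : bool :=
  ((i < j) && ([:: i; j] \notin hat_edges)) || ((j < i) && ([:: j; i] \notin hat_edges)).

Definition hat_coef (f e : seq nat) : int :=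
  nth 0%R (nth [::] hat_inverse (index f hat_faces)) (index e hat_edges).

Lemma hat_adj_sym i j : hat_adj i j = hat_adj j i.
Proof. by rewrite /hat_adj orbC. Qed.

Lemma hat_adj_irr i : hat_adj i i = false.
Proof. by rewrite /hat_adj ltnn. Qed.

Definition below m (P : pred nat) := all P (iota 0 m).

Lemma belowP m (P : pred nat) : below m P -> forall i, i < m -> P i.
Proof. by move=> /allP PP i im; apply: PP; rewrite mem_iota. Qed.

(** Flagness of X, by computation over all triples. *)
Lemma hat_faceP i j l : i < j -> j < l -> l < 14 ->
  ~~ hat_adj i j -> ~~ hat_adj i l -> ~~ hat_adj j l -> [:: i; j; l] \in hat_faces.
Proof.
move=> ij jl l14 /negbTE nij /negbTE nil /negbTE njl.
have j14 := ltn_trans jl l14; have i14 := ltn_trans ij j14.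
have /belowP/(_ i i14)/belowP/(_ j j14)/belowP/(_ l l14) :
    below 14 (fun i => below 14 (fun j => below 14 (fun l =>
    [|| j <= i, l <= j, hat_adj i j, hat_adj i l, hat_adj j l |
    [:: i; j; l] \in hat_faces]))).
  by vm_compute.
by rewrite nij nil njl [j <= i]leqNgt [l <= j]leqNgt ij jl.
Qed.

(** X has dimension 2; by flagness it suffices to test one extra vertex on each listed triangle. *)
Lemma hat_no_tetrahedron i j l m : i < j -> j < l -> l < m -> m < 14 ->
    ~~ hat_adj i j -> ~~ hat_adj i l -> ~~ hat_adj j l ->
  [|| hat_adj i m, hat_adj j m | hat_adj l m].
Proof.
move=> ij jl lm m14 nij nil njl; have l14 := ltn_trans lm m14.
have /allP h : all (fun f =>
    below 14 (fun m => has (hat_adj^~ m) f || (m \in f))) hat_faces.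
  by vm_compute.
have := belowP (h _ (hat_faceP ij jl l14 nij nil njl)) m14.
rewrite /= orbF !inE => /orP[//|]; lia.
Qed.

Lemma hat_contraction i j l f : [:: i; j; l] \in hat_faces -> f \in hat_faces ->
  (hat_coef f [:: j; l] - hat_coef f [:: i; l] + hat_coef f [:: i; j] =
    ([:: i; j; l] == f)%:R)%R.
Proof.
have /allP h : all (fun g => if g is [:: i; j; l] then
    let a := index [:: j; l] hat_edges in let b := index [:: i; l] hat_edges in
    let c := index [:: i; j] hat_edges in let p := index g hat_faces in
    below 31 (fun q => let r := nth [::] hat_inverse q in
      nth 0 r a - nth 0 r b + nth 0 r c == (p == q)%:R)%R
  else true) hat_faces.
  by vm_compute.
move=> gF fF; have f31 : index f hat_faces < 31.
  by rewrite -[31]/(size hat_faces) index_mem.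
have /eqP := belowP (h _ gF) f31; rewrite /hat_coef => ->.
by congr (nat_of_bool _)%:R%R; apply/eqP/eqP => [|->//]; apply: index_inj.
Qed.

Definition hat_nonedges :=
  [seq e <- [seq (i, j) | i <- iota 0 14, j <- iota 0 14] | hat_adj e.1 e.2].

Lemma hat_nonedgesP e : e \in hat_nonedges -> [/\ e.1 < 14, e.2 < 14 & hat_adj e.1 e.2].
Proof.
rewrite mem_filter => /andP[ae /allpairsP[[i j] [im jm eE]]].
by rewrite mem_iota in im; rewrite mem_iota in jm; rewrite eE in ae *.
Qed.

(** An edge of X lies in two triangles, whose third vertices are adjacent in G since X has no
    tetrahedron. So at most two vertices of a face never dominate all edges of G. *)
Lemma hat_uncovered a b : a < 14 -> b < 14 -> ~~ hat_adj a b ->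
  exists i j, [/\ i < 14, j < 14, hat_adj i j,
    ~~ hat_adj a i && ~~ hat_adj a j & ~~ hat_adj b i && ~~ hat_adj b j].
Proof.
move=> a14 b14 /negbTE ab.
have : below 14 (fun a =>
    let r := [seq e <- hat_nonedges | ~~ hat_adj a e.1 && ~~ hat_adj a e.2] in
    below 14 (fun b => hat_adj a b || has (fun e => ~~ hat_adj b e.1 && ~~ hat_adj b e.2) r)).
  by vm_compute.
move=> /belowP/(_ a a14)/belowP/(_ b b14); rewrite ab => /hasP[e + be].
by rewrite mem_filter => /andP[ae /hat_nonedgesP[]]; exists e.1, e.2.
Qed.

End Hat.

(** * The graphs H_k *)

Section HatGraph.

Variable k : nat.
Notation V := 'I_(2 * k * 14).
Implicit Types (u v s t : V) (S T A : {set V}).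

(* Vertex v is vertex [pos v] of the copy number [block v] of the 14-vertex graph. *)
Definition block v := v %/ 14.
Definition pos v := v %% 14.
Definition side v := block v < k.

Definition hat_graph_adj : rel V := fun u v =>
  if side u == side v then (block u == block v) && hat_adj (pos u) (pos v) else true.

Lemma hat_graph_sym : ssrbool.symmetric hat_graph_adj.
Proof. by move=> u v; rewrite /hat_graph_adj eq_sym [block u == _]eq_sym hat_adj_sym. Qed.

Lemma hat_graph_irr : irreflexive hat_graph_adj.
Proof. by move=> u; rewrite /hat_graph_adj !eqxx hat_adj_irr. Qed.

Definition hat_graph := SGraph hat_graph_sym hat_graph_irr.

Notation indep := (independent hat_graph).

Lemma vertex j i : j < 2 * k -> i < 14 -> exists2 v, block v = j & pos v = i.
Proof.
move=> jk i14; have lt : j * 14 + i < 2 * k * 14 by lia.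
by exists (Ordinal lt); rewrite /block /pos /=; lia.
Qed.

Lemma block_lt v : block v < 2 * k.
Proof. by rewrite /block ltn_divLR // ltn_ord. Qed.

Lemma vertex_inj u v : block u = block v -> pos u = pos v -> u = v.
Proof. by rewrite /block /pos => buv puv; apply: val_inj => /=; lia. Qed.

Lemma hat_graph_connected : 0 < k -> connected hat_graph.
Proof.
move=> k0; rewrite /connected; apply/andP; split; first by lia.
have [a ab _] := @vertex 0 0 (ltac:(lia)) isT.
have [b bb _] := @vertex k 0 (ltac:(lia)) isT.
have sa : side a by rewrite /side ab.
have sb : side b = false by rewrite /side bb ltnn.
have cross u v : side u != side v -> connect hat_graph u v.
  by move=> suv; apply: connect1; rewrite /= /hat_graph_adj (negbTE suv).
apply/forallP=> u; apply/forallP=> v.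
case: (eqVneq (side u) (side v)) => [suv|/cross //].
(* Two vertices on the same side are joined through any vertex of the other side. *)
have [w sw] : exists w, side w != side u.
  by case su: (side u); [exists b; rewrite sb | exists a; rewrite sa].
by apply: (connect_trans (y := w)); apply: cross; rewrite -?suv // eq_sym.
Qed.

Lemma indep_nadj S u v : indep S -> u \in S -> v \in S -> ~~ hat_graph_adj u v.
Proof. by move=> /forall_inP iS /iS /forall_inP iu /iu. Qed.

Lemma indepP S : (forall u v, u \in S -> v \in S -> ~~ hat_graph_adj u v) -> indep S.
Proof. by move=> nadj; apply/forall_inP=> u uS; apply/forall_inP=> v; apply: nadj. Qed.

Lemma indep_side S u v : indep S -> u \in S -> v \in S -> side u = side v.
Proof.
move=> iS uS vS; have := indep_nadj iS uS vS; rewrite /hat_graph_adj.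
by case: eqP.
Qed.

Lemma indep_hat S u v : indep S -> u \in S -> v \in S -> block u = block v ->
  ~~ hat_adj (pos u) (pos v).
Proof.
move=> iS uS vS buv; have := indep_nadj iS uS vS.
by rewrite /hat_graph_adj /side buv !eqxx.
Qed.

Lemma pos_ltn u v : block u = block v -> u < v -> pos u < pos v.
Proof. by rewrite /block /pos; lia. Qed.

Lemma pos_lt14 v : pos v < 14.
Proof. by rewrite /pos ltn_pmod. Qed.

Lemma sorted_enum_set S : sorted (fun u v => u < v) (enum S).
Proof.
rewrite -[sorted _ _]/(sorted (relpre val ltn) _) -sorted_map.
apply: (subseq_sorted ltn_trans) (iota_ltn_sorted 0 _).
rewrite -val_enum_ord; apply: map_subseq.
have -> : enum S = [seq v <- enum V | v \in S] by rewrite [RHS]/filter enumT.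
exact: filter_subseq.
Qed.

Lemma block_indep_le3 j S : indep S -> (forall v, v \in S -> block v = j) -> #|S| <= 3.
Proof.
move=> iS Sj; rewrite leqNgt cardE; apply/negP.
have := sorted_enum_set S; have := mem_enum S.
case: (enum S) => [|a [|b [|c [|d l]]]] //= inS /and4P[ab bc cd _] _.
have aS : a \in S by rewrite -inS inE eqxx.
have bS : b \in S by rewrite -inS !inE eqxx orbT.
have cS : c \in S by rewrite -inS !inE eqxx !orbT.
have dS : d \in S by rewrite -inS !inE eqxx !orbT.
have E u v : u \in S -> v \in S -> block u = block v by move=> /Sj -> /Sj ->.
have H u v uS vS := indep_hat iS uS vS (E u v uS vS).
have := hat_no_tetrahedron (pos_ltn (E _ _ aS bS) ab) (pos_ltn (E _ _ bS cS) bc)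
  (pos_ltn (E _ _ cS dS) cd) (pos_lt14 d) (H _ _ aS bS) (H _ _ aS cS) (H _ _ bS cS).
by rewrite !(negbTE (H _ _ _ _)).
Qed.

Definition poss S := [seq pos v | v <- enum S].

Lemma enum_setD1 S u : enum (S :\ u) = [seq v <- enum S | v != u].
Proof.
rewrite /enum_mem -filter_predI; apply: eq_filter => v /=.
by rewrite !inE.
Qed.

Lemma block_face3 j S : indep S -> (forall v, v \in S -> block v = j) -> #|S| = 3 ->
  exists a b c, [/\ enum S = [:: a; b; c], a < b, b < c &
    [:: pos a; pos b; pos c] \in hat_faces].
Proof.
move=> iS Sj; rewrite cardE; have := sorted_enum_set S; have := mem_enum S.
case: (enum S) => [|a [|b [|c [|d l]]]] //= inS /and3P[ab bc _] _.
have aS : a \in S by rewrite -inS inE eqxx.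
have bS : b \in S by rewrite -inS !inE eqxx orbT.
have cS : c \in S by rewrite -inS !inE eqxx !orbT.
have E u v : u \in S -> v \in S -> block u = block v by move=> /Sj -> /Sj ->.
have H u v uS vS := indep_hat iS uS vS (E u v uS vS).
exists a, b, c; split=> //.
exact: hat_faceP (pos_ltn (E _ _ aS bS) ab) (pos_ltn (E _ _ bS cS) bc) (pos_lt14 c)
  (H _ _ aS bS) (H _ _ aS cS) (H _ _ bS cS).
Qed.

Lemma card_set_in (P : pred V) S : #|[set t in S | P t]| = count P (enum S).
Proof.
rewrite cardE -size_filter /enum_mem -filter_predI; congr size; apply: eq_filter => v /=.
by rewrite !inE andbC.
Qed.

(** * Regularity of the graphs H_k *)

Section Field.
Local Open Scope ring_scope.
Variable K : fieldType.

Definition hat_contr R S : K := (hat_coef (poss R) (poss S))%:~R.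

(** Within a block the order of vertices is that of positions, so a triangle has signs +, -, + and
    the sum is the one in [hat_contraction]. *)
Lemma hat_contrP j S R : indep S -> (forall v, v \in S -> block v = j) -> #|S| = 3%N ->
    indep R -> (forall v, v \in R -> block v = j) -> #|R| = 3%N ->
  \sum_(s in S) sgn K s S * hat_contr R (S :\ s) = (S == R)%:R.
Proof.
move=> iS Sj S3 iR Rj R3.
have [a [b [c [ES ab bc SF]]]] := block_face3 iS Sj S3.
have [a' [b' [c' [ER _ _ RF]]]] := block_face3 iR Rj R3.
have ac := ltn_trans ab bc.
have -> : (S == R) = ([:: pos a; pos b; pos c] == [:: pos a'; pos b'; pos c']).
  apply/eqP/eqP => [SR|[pa pb pc]]; first by move: ER; rewrite -SR ES => -[-> -> ->].
  have Sb v : v \in enum S -> block v = j by rewrite mem_enum => /Sj.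
  have Rb v : v \in enum R -> block v = j by rewrite mem_enum => /Rj.
  have E : enum S = enum R.
    rewrite ES ER in Sb Rb *; congr [:: _; _; _]; apply: vertex_inj => //;
    by rewrite Sb ?Rb // !inE eqxx ?orbT.
  by apply/setP=> v; rewrite -[LHS]mem_enum -[RHS]mem_enum E.
have lt_ne u v : (u < v)%N -> (u == v = false) * (v == u = false) * ((v < u)%N = false).
  move=> uv; rewrite [v == u]eq_sym ltnNge (ltnW uv).
  by rewrite -val_eqE /= ltn_eqF.
have {}E := (ab, bc, ac, lt_ne _ _ ab, lt_ne _ _ bc, lt_ne _ _ ac, ltnn, eqxx).
rewrite -big_enum /= ES !big_cons big_nil /sgn !card_set_in ES.
rewrite /hat_contr /poss !enum_setD1 ES ER.
rewrite /= !E /= !(expr0, expr1, expr2, mul1r, mulN1r, opprK, addr0) addrA.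
rewrite -intrB -intrD (hat_contraction SF RF).
by case: eqP.
Qed.

(** On one side the complex is the join of its blocks. The lowest block [P] is split off; the join
    lemma with [d = 2] raises the bound by 2 per block, since the splitting restricts to every
    subset of vertices. *)
Lemma hat_graph_face_exact (E : lmodType K) hi m T q :
    (forall v, v \in T -> hi - m <= block v < hi)%N ->
    (forall u v, u \in T -> v \in T -> side u = side v) -> (2 * m < q)%N ->
  face_exact (K := K) indep E T q.
Proof.
elim: m T q => [|m IHm] T q Tb Ts mq.
  have -> : T = set0 by apply/setP=> v; rewrite inE; apply/negP=> /Tb; lia.
  by apply: face_exact_card; rewrite cards0; lia.
pose P := [set v in T | block v == hi - m.+1]%N; pose Q := T :\: P.
have PT v : v \in P -> v \in T /\ block v = (hi - m.+1)%N.
  by rewrite inE => /andP[? /eqP].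
have QT v : v \in Q -> v \in T /\ (hi - m.+1 < block v < hi)%N.
  rewrite !inE => /andP[+ vT]; rewrite vT /= => vb; have := Tb v vT.
  by split=> //; move: vb; lia.
have -> : T = P :|: Q.
  by apply/setP=> v; rewrite !inE; case: (v \in T); case: eqP.
have bPQ u v : u \in P -> v \in Q -> (block u < block v)%N.
  by move=> /PT[_ ->] /QT[_ /andP[]].
apply: (@face_exact_join _ K E indep (@independentS _ _) P Q 2 (2 * m) (hat_contr)).
- move=> u v uP vQ; have := bPQ u v uP vQ; rewrite /block; lia.
- move=> S R SP RQ iS iR; apply: indepP => u v.
  have nPQ s t : s \in S -> t \in R -> ~~ hat_graph_adj s t && ~~ hat_graph_adj t s.
    move=> /(subsetP SP) sP /(subsetP RQ) tQ.
    rewrite [hat_graph_adj t s]hat_graph_sym andbb.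
    rewrite /hat_graph_adj (Ts _ _ (PT s sP).1 (QT t tQ).1) eqxx.
    by rewrite ltn_eqF ?bPQ.
  rewrite !inE => /orP[uS|uR] /orP[vS|vR].
  + exact: indep_nadj iS uS vS.
  + by case/andP: (nPQ u v uS vR).
  + by case/andP: (nPQ v u vS uR).
  exact: indep_nadj iR uR vR.
- move=> S SP iS; apply: (@block_indep_le3 (hi - m.+1)%N) => // v vS.
  by case: (PT v (subsetP SP _ vS)).
- move=> S R SP iS S3 RP iR R3; apply: (@hat_contrP (hi - m.+1)%N) => // v vS.
    by case: (PT v (subsetP SP _ vS)).
  by case: (PT v (subsetP RP _ vS)).
- move=> p mp; apply: IHm => //.
    by move=> v /QT[_]; lia.
  by move=> u v /QT[uT _] /QT[vT _]; apply: Ts.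
by lia.
Qed.

(** A face meets only one side, so the complex is the disjoint union of its two sides. *)
Lemma hat_graph_exact (E : lmodType K) T q : (0 < k)%N -> (2 * k < q)%N ->
  face_exact (K := K) indep E T q.
Proof.
move=> k0 kq; pose P := [set v in T | side v]; pose Q := [set v in T | ~~ side v].
apply: (@face_exact_union _ K E indep P Q).
- lia.
- by rewrite -setI_eq0; apply/eqP/setP=> v; rewrite !inE; case: side; rewrite ?andbF.
- by apply/subsetP=> v; rewrite inE => /andP[].
- by apply/subsetP=> v; rewrite inE => /andP[].
- move=> S ST iS; case: (set_0Vmem S) => [->|[u uS]]; first by rewrite sub0set.
  case su: (side u); apply/orP; [left|right]; apply/subsetP=> v vS;
  rewrite inE (subsetP ST) //=;
  by rewrite (indep_side iS vS uS) su.
- apply: (@hat_graph_face_exact E k k) => //.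
    by move=> v; rewrite inE => /andP[_]; rewrite /side; lia.
  by move=> u v; rewrite !inE => /andP[_ ->] /andP[_ ->].
apply: (@hat_graph_face_exact E (2 * k) k) => //.
  by move=> v; rewrite inE => /andP[_]; rewrite /side; have := block_lt v; lia.
by move=> u v; rewrite !inE => /andP[_ /negbTE->] /andP[_ /negbTE->].
Qed.

(* Positions 0, 1, 2, 3 span the 4-cycle 0-2-1-3 of the complex, so the independence
   complex of [squares j] is a join of 2 (k - j) pairs of points: a sphere. *)
Definition squares j : {set V} := [set v | (j <= block v < k)%N && (pos v < 4)%N].

(** Induction on the number of blocks: positions 0, 1 and then 2, 3 of the lowest block are two
    pairs of suspension points, so exactness would descend by two degrees per block. *)
Lemma squares_not_exact (E : lmodType K) (e : E) j : e != 0 -> (j <= k)%N ->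
  ~ face_exact (K := K) indep E (squares j) (2 * (k - j)).
Proof.
move=> e0 jk; rewrite -{1}(subKn jk); have: (k - j <= k)%N by apply: leq_subr.
elim: (k - j)%N => {j jk} [|m IHm] mk.
  (* No block is left: the value [e] at the empty face is a cocycle, and only 0 is a coboundary
     there. *)
  rewrite muln0 subn0 => /face_exactP/(_ (fun=> e))[S|y yE].
    move=> /subsetP Sk S1; have /card_gt0P[v vS] : (0 < #|S|)%N by rewrite S1.
    by have := Sk v vS; rewrite inE; lia.
  have := yE set0 (sub0set _) (cards0 _) (independent0 _).
  by rewrite /cob big_set0 => /eqP; rewrite (negbTE e0).
move=> ex; apply: (IHm (ltnW mk)).
have vtx i : (i < 14)%N -> exists2 v, block v = (k - m.+1)%N & pos v = i.
  by apply: vertex; lia.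
have [a ab ap] := vtx 0 isT; have [b bb bp] := vtx 1 isT.
have [c cb cp] := vtx 2 isT; have [d db dp] := vtx 3 isT.
have sqE : squares (k - m.+1) = a |: (b |: (c |: (d |: squares (k - m)))).
  apply/setP=> v; rewrite !inE; apply/idP/idP.
    case: (ltnP (k - m.+1) (block v)) => [lt|ge] /andP[/andP[le lt'] p4].
      by rewrite p4 andbT (_ : (k - m <= block v < k)%N) ?orbT //; lia.
    have bv : block v = (k - m.+1)%N by lia.
    have vE u : block u = (k - m.+1)%N -> pos u = pos v -> (v == u).
      by move=> bu pu; apply/eqP/vertex_inj; rewrite ?bu.
    move: p4; case pv: (pos v) => [|[|[|[|p]]]] // _.
    - by rewrite vE // pv.
    - by rewrite (vE b) ?orbT // pv.
    - by rewrite (vE c) ?orbT // pv.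
    - by rewrite (vE d) ?orbT // pv.
  case/or4P => [/eqP->|/eqP->|/eqP->|/orP[/eqP->|]].
  - rewrite ab ap; lia.
  - rewrite bb bp; lia.
  - rewrite cb cp; lia.
  - rewrite db dp; lia.
  lia.
have far x v : block x = (k - m.+1)%N -> v \in squares (k - m) ->
    (x < v)%N /\ ~~ hat_graph_adj x v.
  rewrite inE => xb /andP[/andP[kv vk] _]; split.
    by move: xb; rewrite /block in kv *; lia.
  by rewrite /hat_graph_adj /side vk xb (_ : (k - m.+1 < k)%N) ?ltn_eqF //; lia.
have near x y : block x = (k - m.+1)%N -> block y = (k - m.+1)%N ->
    hat_graph_adj x y = hat_adj (pos x) (pos y).
  by move=> xb yb; rewrite /hat_graph_adj /side xb yb !eqxx.
have lt x y : block x = (k - m.+1)%N -> block y = (k - m.+1)%N ->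
    (pos x < pos y)%N -> (x < y)%N.
  by rewrite /block /pos; lia.
move: ex; rewrite sqE [(2 * m.+1)%N](_ : _ = (2 * m).+2); last by lia.
have edge x y S : hat_graph_adj x y -> x \in S -> y \in S -> ~~ indep S.
  by move=> xy xS yS; apply: contraL xy => iS; apply: indep_nadj iS xS yS.
have cone x S (P : {set V}) : (forall v, v \in P -> ~~ hat_graph_adj x v) ->
    S \subset P -> indep S -> indep (x |: S).
  move=> xP /subsetP SP iS; apply: indepP => u v; rewrite !inE.
  move=> /predU1P[->|uS] /predU1P[->|vS]; rewrite ?hat_graph_irr ?xP ?SP //.
    by rewrite hat_graph_sym xP ?SP.
  exact: indep_nadj iS uS vS.
have cdn x v : block x = (k - m.+1)%N -> (pos x < 2)%N ->
    v \in c |: (d |: squares (k - m)) -> ~~ hat_graph_adj x v.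
  move=> xb xp; rewrite in_setU1 in_setU1 => /or3P[/eqP->|/eqP->|/(far _ _ xb)[] //].
    by rewrite near // cp; case: (pos x) xp => [|[]].
  by rewrite near // dp; case: (pos x) xp => [|[]].
move=> ex; have {}ex :
    face_exact (K := K) indep E (c |: (d |: squares (k - m))) (2 * m).+1.
  apply: (face_exact_suspension (@independentS _ _) _ _ _ _ ex).
  - by apply: lt; rewrite ?ap ?bp.
  - move=> v; rewrite in_setU1 in_setU1 => /or3P[/eqP->|/eqP->|/(far _ _ bb)[] //].
      by apply: lt; rewrite ?cp ?bp.
    by apply: lt; rewrite ?dp ?bp.
  - by move=> S; apply: edge; rewrite near // ap bp.
  by move=> S SP iS; split; apply: cone SP iS => v; apply: cdn; rewrite ?ap ?bp.
apply: (face_exact_suspension (@independentS _ _) _ _ _ _ ex).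
- by apply: lt; rewrite ?cp ?dp.
- by move=> v /(far _ _ db)[].
- by move=> S; apply: edge; rewrite near // cp dp.
by move=> S SP iS; split; apply: cone SP iS => v;
  [move=> /(far _ _ cb)[] | move=> /(far _ _ db)[]].
Qed.

Lemma hat_graph_reg : (0 < k)%N -> is_reg K hat_graph (2 * k).
Proof.
move=> k0; apply: is_reg_cochain => [T q|]; first exact: hat_graph_exact.
have e0 : const_mx 1 != 0 :> 'rV[K]_1.
  by apply/eqP=> /rowP/(_ 0); rewrite !mxE; apply/eqP/oner_neq0.
have nex : ~ face_exact (K := K) indep 'rV[K]_1 (squares 0) (2 * k).
  by have := squares_not_exact e0 (leq0n k); rewrite subn0.
(* If [squares 0] had at most [2 * k] elements, a face with [2 * k] vertices would be all of it, yet
   positions 0 and 1 of block 0 are adjacent in the graph; exactness would then be vacuous. *)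
exists (squares 0) => //; rewrite ltnNge; apply/negP=> le; apply: nex.
apply/face_exactP=> z _; exists z => S S0 Sk iS.
have {S0} ES : S = squares 0 by apply/eqP; rewrite eqEcard S0 Sk.
have [a ab ap] := @vertex 0 0 (ltac:(lia)) isT.
have [b bb bp] := @vertex 0 1 (ltac:(lia)) isT.
have inS x : block x = 0%N -> (pos x < 4)%N -> x \in S.
  by rewrite ES inE => -> ->; rewrite k0.
have := indep_hat iS (inS a ab _) (inS b bb _); rewrite ap bp ab bb.
by move=> /(_ isT isT erefl).
Qed.

End Field.

(** * The v-number of the graphs H_k *)

Lemma card_blocks A : #|A| = \sum_(j < 2 * k) #|[set v in A | block v == j]|.
Proof.
rewrite -sum1_card (partition_big (fun v => Ordinal (block_lt v)) xpredT) //=.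
apply: eq_bigr => j _; rewrite -sum1_card; apply: eq_bigl => v.
by rewrite !inE -val_eqE.
Qed.

(** With at most two vertices of [A] in a block on its side, [hat_uncovered] gives an edge of that
    block with no end in the neighborhood of [A], which is then no vertex cover. *)
Lemma v_family_block A j : A \in v_family hat_graph ->
    (exists2 u, u \in A & side u = (j < k)) ->
  j < 2 * k -> #|[set v in A | block v == j]| = 3.
Proof.
rewrite inE => /andP[iA /minsetP[cov _]] [u uA uj] jk; apply/eqP; rewrite eqn_leq.
have iB : indep [set v in A | block v == j].
  by apply: independentS iA; apply/subsetP=> v; rewrite inE => /andP[].
rewrite (@block_indep_le3 j) // => [|v]; last by rewrite inE => /andP[_ /eqP].
rewrite ltnNge; apply/negP=> le2.
have [x [y [x14 y14 xy Bxy]]] : exists x y, [/\ x < 14, y < 14, hat_adj x y &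
    forall v, v \in A -> block v = j -> ~~ hat_adj (pos v) x && ~~ hat_adj (pos v) y].
  have [a [b [a14 b14 ab Bab]]] : exists a b, [/\ a < 14, b < 14, ~~ hat_adj a b &
      forall v, v \in [set v in A | block v == j] -> (pos v == a) || (pos v == b)].
    move: le2 iB; rewrite cardE; set B := [set v in A | _] => le2 iB.
    have Bj v : v \in B -> block v = j by rewrite inE => /andP[_ /eqP].
    have := mem_enum B; case: (enum B) le2 => [|a [|b [|]]] //= _ inB.
    (* A block with fewer than two vertices of [A] is padded: position 0 twice if empty, the single
       position repeated otherwise. *)
    - by exists 0, 0; split=> // v; rewrite -inB.
    - exists (pos a), (pos a); rewrite pos_lt14 hat_adj_irr; split=> // v.
      by rewrite -inB inE => /eqP->; rewrite eqxx.
    have aB : a \in B by rewrite -inB !inE eqxx.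
    have bB : b \in B by rewrite -inB !inE eqxx orbT.
    exists (pos a), (pos b); rewrite !pos_lt14 (indep_hat iB) ?Bj //; split=> // v.
    by rewrite -inB !inE => /orP[]/eqP->; rewrite eqxx ?orbT.
  have [x [y [x14 y14 xy ax bx]]] := hat_uncovered a14 b14 ab.
  exists x, y; split=> // v vA vj.
  by have /orP[/eqP->|/eqP->] := Bab v (ltac:(by rewrite inE vA vj /=)).
have [X Xj Xx] := vertex jk x14; have [Y Yj Yy] := vertex jk y14.
have notN Z z : block Z = j -> pos Z = z ->
    (forall v, v \in A -> block v = j -> ~~ hat_adj (pos v) z) ->
    Z \in ~: neighbors hat_graph A.
  move=> Zj Zz Az; rewrite !inE negb_and negbK orbC.
  case: (boolP (Z \in A)) => ZA; rewrite ?orbT // orbF negbK.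
  have nZ v : v \in A -> ~~ hat_graph_adj v Z.
    move=> vA; rewrite /hat_graph_adj (indep_side iA vA uA) uj /side Zj eqxx.
    by case: eqP => //= vj; rewrite Zz Az // vj.
  apply: indepP => v w; rewrite !inE => /predU1P[->|vA] /predU1P[->|wA].
  - by rewrite hat_graph_irr.
  - by rewrite hat_graph_sym nZ.
  - exact: nZ.
  exact: indep_nadj iA vA wA.
have nX := notN X x Xj Xx (fun v vA vj => proj1 (andP (Bxy v vA vj))).
have nY := notN Y y Yj Yy (fun v vA vj => proj2 (andP (Bxy v vA vj))).
have := indep_nadj cov nX nY.
by rewrite /hat_graph_adj /side Xj Yj !eqxx Xx Yy xy.
Qed.

Lemma v_family_card A : 0 < k -> A \in v_family hat_graph -> #|A| = 3 * k.
Proof.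
move=> k0 vA; have := vA; rewrite inE => /andP[iA /minsetP[cov _]].
have [u uA] : exists u, u \in A.
  (* The empty set has no neighbors, so an edge between the two sides would stay uncovered. *)
  apply/set0Pn/eqP=> A0.
  have [a ab _] := @vertex 0 0 (ltac:(lia)) isT.
  have [b bb _] := @vertex k 0 (ltac:(lia)) isT.
  have inN v : v \in ~: neighbors hat_graph A.
    rewrite A0 !inE /= negbK setU0; apply: indepP => s t /set1P-> /set1P->.
    by rewrite hat_graph_irr.
  have := indep_nadj cov (inN a) (inN b).
  by rewrite /hat_graph_adj /side ab bb k0 ltnn.
have cardj (j : 'I_(2 * k)) : #|[set v in A | block v == j]| =
    if (j < k) == side u then 3 else 0.
  case: eqP => [ju|ju]; first by apply: v_family_block; [|exists u|].
  apply/eqP; rewrite cards_eq0; apply/eqP/setP=> v; rewrite !inE.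
  apply/negP=> /andP[vA' /eqP vj].
  by apply: ju; rewrite -vj; apply: indep_side iA vA' uA.
rewrite card_blocks (eq_bigr _ (fun j _ => cardj j)).
rewrite -(big_mkord xpredT (fun j => if (j < k) == side u then 3 else 0)).
rewrite (@big_cat_nat _ _ _ k) //=; last by lia.
rewrite (eq_big_nat _ _ (F2 := fun=> if side u then 3 else 0)); last first.
  by move=> j /andP[_ ->]; case: side.
rewrite [X in _ + X](eq_big_nat _ _ (F2 := fun=> if side u then 0 else 3)); last first.
  by move=> j /andP[kj _]; rewrite ltnNge kj; case: side.
by rewrite !sum_nat_const_nat; case: side; lia.
Qed.

End HatGraph.

Theorem theorem2 (k : nat) (hk : 1 <= k) :
  exists (n : nat) (H : sgraph n),
    connected H /\
    forall K : fieldType, exists2 r : nat, is_reg K H r & v_number H = r + k.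
Proof.
exists (2 * k * 14), (hat_graph k); split; first exact: hat_graph_connected.
move=> K; exists (2 * k); first exact: hat_graph_reg.
have [[A vA <-] _] := v_numberP (hat_graph k).
by rewrite (v_family_card hk vA); lia.
Qed.
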